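(* Let $a\ge1$ and $m\ge2$ be integers. Then $\mathcal P_m^{(a)}$ is the stable-set polytope of a chordal, hence perfect, graph. It is full-dimensional in $\mathbb R^{am}$ and is Gorenstein of codegree $$\operatorname{codeg}(\mathcal P_m^{(a)})=2a+1.$$ More precisely, for all integers $q\ge2a+1$, $$(q\mathcal P_m^{(a)})^\circ\cap\mathbb Z^{am}=\mathbf 1_{am}+\bigl((q-(2a+1))\mathcal P_m^{(a)}\cap\mathbb Z^{am}\bigr).$$ Consequently $$L_m^{(a)}(-q)=(-1)^{am}L_m^{(a)}\bigl(q-(2a+1)\bigr)$$ as an identity of Ehrhart polynomials. The Ehrhart series has the form $$\operatorname{Ehr}_{\mathcal P_m^{(a)}}(z)=\sum_{q\ge0}L_m^{(a)}(q)z^q=\frac{h_{m,a}^*(z)}{(1-z)^{am+1}},$$ where $h_{m,a}^*(z)$ is a polynomial with $$\deg h_{m,a}^*(z)=a(m-2).$$ Furthermore, $$h_{m,a}^*(z)=z^{a(m-2)}h_{m,a}^*(1/z),$$ and the coefficient sequence of $h_{m,a}^*(z)$ is unimodal.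
   Context: For integers $a\ge1$, $m\ge2$ let $x=(x_{i,j})_{1\le i\le m,\,1\le j\le a}\in\mathbb R^{am}$ and $R_i=x_{i,1}+\cdots+x_{i,a}$. The path block polytope is $\mathcal P_m^{(a)}=\{x\in\mathbb R_{\ge0}^{am}: R_i+R_{i+1}\le1,\ 1\le i\le m-1\}$. For integers $q\ge0$, $L_m^{(a)}(q)=\#(q\mathcal P_m^{(a)}\cap\mathbb Z^{am})$; values at other arguments are those of the Ehrhart polynomial. $\mathbf 1_{am}\in\mathbb Z^{am}$ is the all-one vector and $(\cdot)^\circ$ denotes the topological interior. The stable-set polytope $\operatorname{STAB}(G)$ of a finite graph $G$ is the convex hull in $\mathbb R^{V(G)}$ of the incidence vectors of stable (independent) sets of $G$. The codegree of a full-dimensional lattice polytope $P$ is the least positive integer $c$ such that the interior of $cP$ contains a lattice point. A full-dimensional lattice polytope $P$ is Gorenstein of codegree $c$ if $cP$ has a unique interior lattice point $p$ and $cP-p$ is reflexive (all facets are given by $\langle n,y\rangle\le1$ with $n$ a primitive integral vector). *)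

(* Defs.v *)
From mathcomp Require Import all_boot all_order all_algebra finmap.
From mathcomp Require Import boolp classical_sets functions cardinality reals.
From mathcomp Require Import topology normedtype.

Set Implicit Arguments.
Unset Strict Implicit.
Unset Printing Implicit Defensive.

Import Order.TTheory GRing.Theory Num.Theory.
Import numFieldNormedType.Exports.

Local Open Scope classical_set_scope.
Local Open Scope ring_scope.

Section Affine.
Variables (R : realType) (E : lmodType R).
Implicit Types A : set E.

Definition conv A : set E :=
  [set x | exists (n : nat) (p : 'I_n -> E) (w : 'I_n -> R),
     [/\ forall i, A (p i), forall i, 0 <= w i, \sum_i w i = 1
       & x = \sum_i w i *: p i]].

Definition affine_indep (n : nat) (p : 'I_n -> E) : Prop :=
  forall w : 'I_n -> R,
    \sum_i w i = 0 -> \sum_i w i *: p i = 0 -> forall i, w i = 0.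

Definition aff_dim A (d : nat) : Prop :=
  (exists p : 'I_d.+1 -> E, (forall i, A (p i)) /\ affine_indep p) /\
  (forall p : 'I_d.+2 -> E, (forall i, A (p i)) -> ~ affine_indep p).

End Affine.

(* The ambient space R^V with V = [m] x [n] is 'M[R]_(m, n); its topology is the
   product topology, and the lattice Z^V is the set of integral matrices. *)
Section Polytopes.
Variables (R : realType) (m n : nat).
Implicit Types (P Q F A : set 'M[R]_(m, n)).

Definition dilate (q : nat) A : set 'M[R]_(m, n) :=
  [set q%:R *: x | x in A].

Definition translate (v : 'M[R]_(m, n)) A : set 'M[R]_(m, n) :=
  [set v + x | x in A].

Definition lattice_points A : set 'M[R]_(m, n) :=
  [set x | A x /\ x \is a mxOver Num.int].

Definition lattice_polytope P : Prop :=
  exists s : seq 'M[R]_(m, n),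
    {in s, forall x, x \is a mxOver Num.int} /\ P = conv [set` s].

Definition full_dimensional P : Prop := aff_dim P (m * n).

Definition inner (c x : 'M[R]_(m, n)) : R := \sum_i \sum_j c i j * x i j.

Definition is_face Q F : Prop :=
  exists (c : 'M[R]_(m, n)) (b : R),
    (forall y, Q y -> inner c y <= b) /\ F = [set y | Q y /\ inner c y = b].

Definition is_facet Q F : Prop :=
  is_face Q F /\ exists d, aff_dim Q d.+1 /\ aff_dim F d.

Definition primitive_vector (c : 'M[int]_(m, n)) : Prop :=
  \big[gcdn/0%N]_i \big[gcdn/0%N]_j `|c i j|%N = 1%N.

Definition reflexive_polytope Q : Prop :=
  forall F, is_facet Q F ->
    exists c : 'M[int]_(m, n),
      [/\ primitive_vector c,
          forall y, Q y -> inner (map_mx intr c) y <= 1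
        & F = [set y | Q y /\ inner (map_mx intr c) y = 1]].

Definition is_codegree P (c : nat) : Prop :=
  [/\ (0 < c)%N, lattice_points (dilate c P)° !=set0
    & forall k : nat, (0 < k)%N ->
        lattice_points (dilate k P)° !=set0 -> (c <= k)%N].

Definition gorenstein P (c : nat) : Prop :=
  [/\ full_dimensional P, lattice_polytope P
    & exists p : 'M[R]_(m, n),
        lattice_points (dilate c P)° = [set p] /\
        reflexive_polytope (translate (- p) (dilate c P))].

(* [fset_set] of an infinite set is empty, so this is the number of lattice
   points only when that number is finite, as it is for bounded P. *)
Definition ehrhart_count P (q : nat) : nat :=
  #|` fset_set (lattice_points (dilate q P))|.

Definition is_ehrhart_polynomial P (L : {poly rat}) : Prop :=
  forall q : nat, L.[q%:R] = (ehrhart_count P q)%:R.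

End Polytopes.

(* f = h / g in rat[[z]], where f is given by its coefficients: g * f = h. *)
Definition series_eq_quotient (f : nat -> rat) (h g : {poly rat}) : Prop :=
  forall k : nat, \sum_(i < k.+1) g`_i * f (k - i)%N = h`_k.

Definition rational_function (p : {poly rat}) : {fraction {poly rat}} :=
  FracField.tofrac p.

(* h(1/z) as an element of the field rat(z). *)
Definition eval_at_inverse (h : {poly rat}) : {fraction {poly rat}} :=
  (map_poly (fun c => rational_function c%:P) h).[(rational_function 'X)^-1].

Definition unimodal (s : seq rat) : Prop :=
  exists k : nat, [/\ (k < size s)%N,
    forall i j : nat, (i <= j <= k)%N -> s`_i <= s`_j
  & forall i j : nat, (k <= i <= j)%N -> (j < size s)%N -> s`_j <= s`_i].

Section Graphs.
Variables (V : finType) (e : rel V).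

Definition simple_graph : Prop := symmetric e /\ irreflexive e.

Definition stable (S : {set V}) : bool :=
  [forall x in S, forall y in S, ~~ e x y].

Definition clique (K : {set V}) : bool :=
  [forall x in K, forall y in K, (x != y) ==> e x y].

Definition chordal : Prop :=
  forall c : seq V, uniq c -> cycle e c -> (4 <= size c)%N ->
    exists x y : V,
      [/\ x \in c, y \in c, e x y, y != next c x & x != next c y].

Definition clique_number (U : {set V}) : nat :=
  \max_(K : {set V} | (K \subset U) && clique K) #|K|.

Definition colorable (U : {set V}) (k : nat) : Prop :=
  exists f : V -> nat,
    {in U, forall x, (f x < k)%N} /\ {in U &, forall x y, e x y -> f x != f y}.

Definition is_chromatic_number (U : {set V}) (k : nat) : Prop :=
  colorable U k /\ forall l : nat, colorable U l -> (k <= l)%N.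

Definition perfect : Prop :=
  forall U : {set V}, is_chromatic_number U (clique_number U).

End Graphs.

Definition STAB (R : realType) (m n : nat) (e : rel ('I_m * 'I_n)) :
    set 'M[R]_(m, n) :=
  conv [set x | exists S : {set 'I_m * 'I_n},
                  stable e S /\ x = \matrix_(i, j) ((i, j) \in S)%:R].
Arguments STAB R {m n} e _.

Definition path_block_polytope (R : realType) (a m : nat) : set 'M[R]_(m, a) :=
  [set x | (forall i j, 0 <= x i j) /\
           (forall i i' : 'I_m, i' = i.+1 :> nat ->
              \sum_j x i j + \sum_j x i' j <= 1)].

Arguments path_block_polytope : clear implicits.

(* Main.v *)
Require Import Defs.
From mathcomp Require Import all_boot all_order all_algebra finmap.
From mathcomp Require Import boolp classical_sets functions cardinality reals.
From mathcomp Require Import topology normedtype.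
From mathcomp Require Import fintype finset.
From mathcomp Require Import ring lra zify.

Import Order.TTheory GRing.Theory Num.Theory.
Import numFieldNormedType.Exports.
Local Open Scope ring_scope.

Set Implicit Arguments.
Unset Strict Implicit.
Unset Printing Implicit Defensive.

(* The lattice points of q P are the order-preserving maps of a graded poset, the zigzag
   of m elements with each element replaced by a chain of length a.  Adding to each value
   half the rank turns the relations of consecutive ranks into alternately strict and weak
   ones (Braenden's sign-graded posets), and the values now lie in [0, q + a].  Colour the
   elements by the parity of the rank and split such a map into maximal monochromatic runs
   of values.  The maps with prescribed runs A_1, ..., A_s have generating function
   z^(s/2) E_1(z) ... E_s(z) / (1 - z)^(am+1), with E_i the Eulerian polynomial of
   degree |A_i| - 1; every such numerator is gamma-positive with centre am/2, whatever the
   runs are.  Hence so is their sum z^a h*(z), which gives the symmetry, the degree and the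
   unimodality of h*, and the symmetry of h* gives the reciprocity.

   A point of P is a convex combination of stable sets by cutting [0, 1] into slots of
   lengths x_(i,j), from the left for one parity of i and from the right for the other. *)

(** * Gamma-positive numerators of rational generating functions *)

(** The centre is the same for all choices of runs because minimal elements have even rank and
    maximal ones odd rank: the runs alternate in colour from an even one at the bottom to an odd one
    at the top, so [s] is even. A run with [t] elements contributes a symmetric polynomial of degree
    [t - 1], and the strict step into each of the [s/2] odd runs a factor [z], which adds 2 to the
    sum of the lowest and the highest exponent. That sum is therefore
    [sum (|A_i| - 1) + 2 (s/2) = am]. With values in [[0, n]] there is no such map for [n < a] and
    exactly one for [n = a]. Hence the numerator starts at [z^a] with coefficient 1, by symmetry it
    ends at [z^(am - a)], and [h*] has degree [am - 2a]. Gamma-positivity is the property carried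
    along because it defines a cone closed under products, on which linear statements, the Eulerian
    recurrence among them, are checked on the generators [z^i (1 + z)^(c - 2i)]. *)

Inductive gamma_pos (c : nat) : {poly rat} -> Prop :=
| gamma_pos0 : gamma_pos c 0
| gamma_posD p q : gamma_pos c p -> gamma_pos c q -> gamma_pos c (p + q)
| gamma_pos_basis (r : rat) i : 0 <= r -> (i.*2 <= c)%N ->
    gamma_pos c (r *: ('X^i * (1 + 'X) ^+ (c - i.*2))).

Lemma gamma_posM c d p q :
  gamma_pos c p -> gamma_pos d q -> gamma_pos (c + d) (p * q).
Proof.
move=> gp gq; elim: gp => [|p1 p2 _ IH1 _ IH2|r i r0 ic].
- by rewrite mul0r; apply: gamma_pos0.
- by rewrite mulrDl; apply: gamma_posD.
elim: gq => [|q1 q2 _ IH1 _ IH2|s j s0 jd].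
- by rewrite mulr0; apply: gamma_pos0.
- by rewrite mulrDr; apply: gamma_posD.
rewrite -scalerAl -scalerAr scalerA mulrACA -!exprD.
have -> : (c - i.*2 + (d - j.*2) = c + d - (i + j).*2)%N by lia.
by apply: gamma_pos_basis; [apply: mulr_ge0 | lia].
Qed.

Lemma coef_gamma_basis c i k : (i.*2 <= c)%N ->
  ('X^i * (1 + 'X) ^+ (c - i.*2) : {poly rat})`_k =
  if (k < i)%N then 0 else ('C(c - i.*2, k - i))%:R.
Proof.
move=> ic; rewrite coefXnM; case: ltnP => // ki.
rewrite exprDn coef_sum.
under eq_bigr => j _ do rewrite expr1n mul1r coefMn coefXn.
case: (leqP (k - i) (c - i.*2)) => hk.
  have hk' : (k - i < (c - i.*2).+1)%N by [].
  rewrite (bigD1 (Ordinal hk')) //= eqxx big1 ?addr0 //.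
  by move=> j; rewrite -val_eqE /= eq_sym => /negbTE ->; rewrite mul0rn.
rewrite bin_small // big1 // => j _.
case: eqP => [h|]; last by rewrite mul0rn.
by move: (ltn_ord j); lia.
Qed.

Lemma gamma_pos_sym c p k : gamma_pos c p -> (k <= c)%N -> p`_k = p`_(c - k).
Proof.
move=> gp kc; elim: gp => [|p1 p2 _ IH1 _ IH2|r i r0 ic].
- by rewrite !coef0.
- by rewrite !coefD IH1 IH2.
rewrite !coefZ !coef_gamma_basis //; congr (_ * _).
case: ltnP => h1; case: ltnP => h2 //; try by rewrite bin_small //; lia.
by rewrite -bin_sub; [congr (('C(_, _))%:R); lia | lia].
Qed.

Lemma gamma_pos_gt c p k : gamma_pos c p -> (c < k)%N -> p`_k = 0.
Proof.
move=> gp kc; elim: gp => [|p1 p2 _ IH1 _ IH2|r i r0 ic].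
- by rewrite !coef0.
- by rewrite !coefD IH1 IH2 addr0.
rewrite !coefZ !coef_gamma_basis //.
by case: ltnP => h1; rewrite ?mulr0 // bin_small ?mulr0 //; lia.
Qed.

Lemma leq_bin_half n k : (k.*2 < n)%N -> ('C(n, k) <= 'C(n, k.+1))%N.
Proof.
move=> h; have := mul_bin_left n k => e.
have: (k.+1 * 'C(n, k) <= k.+1 * 'C(n, k.+1))%N.
  by rewrite e leq_mul2r; apply/orP; right; lia.
by rewrite leq_pmul2l.
Qed.

Lemma gamma_pos_mono c p k : gamma_pos c p -> (k.*2 < c)%N -> p`_k <= p`_k.+1.
Proof.
move=> gp kc; elim: gp => [|p1 p2 _ IH1 _ IH2|r i r0 ic].
- by rewrite !coef0.
- by rewrite !coefD lerD.
rewrite !coefZ !coef_gamma_basis //; apply: ler_wpM2l => //.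
case: ltnP => h1; case: ltnP => h2 //; try by lia.
rewrite ler_nat subSn //; apply: leq_bin_half; lia.
Qed.

(** * Power series through their truncations *)

(** Congruence modulo ['X^N]. An identity of series is a congruence of truncations for every [N]. *)
Definition eqmod N (p q : {poly rat}) := forall k, (k < N)%N -> p`_k = q`_k.

Lemma eqmod_trans N p q r : eqmod N p q -> eqmod N q r -> eqmod N p r.
Proof. by move=> h h' k hk; rewrite h // h'. Qed.

Lemma eqmodM N p p' q q' :
  eqmod N p p' -> eqmod N q q' -> eqmod N (p * q) (p' * q').
Proof.
move=> hp hq k hk; rewrite !coefM; apply: eq_bigr => i _.
by rewrite hp ?hq //; move: (ltn_ord i); lia.
Qed.

Lemma eqmodMl N p q r : eqmod N p q -> eqmod N (p * r) (q * r).
Proof. by move=> h; apply: eqmodM. Qed.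

Lemma eqmodD N p p' q q' :
  eqmod N p p' -> eqmod N q q' -> eqmod N (p + q) (p' + q').
Proof. by move=> hp hq k hk; rewrite !coefD hp ?hq. Qed.

Definition trunc_series (f : nat -> rat) N : {poly rat} := \poly_(i < N) f i.

(* f has generating series W / (1 - z)^d. *)
Definition has_gf (f : nat -> rat) (W : {poly rat}) d :=
  forall N, eqmod N (trunc_series f N * (1 - 'X) ^+ d) W.

Lemma coef_trunc_series f N k : (k < N)%N -> (trunc_series f N)`_k = f k.
Proof. by move=> h; rewrite coef_poly h. Qed.

Lemma has_gf_ext f f' W d : f =1 f' -> has_gf f W d -> has_gf f' W d.
Proof.
move=> e h N; apply: eqmod_trans (h N); apply: eqmodMl => k hk.
by rewrite !coef_trunc_series.
Qed.

Lemma has_gf0 d : has_gf (fun=> 0) 0 d.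
Proof.
move=> N; have -> : trunc_series (fun=> 0) N = 0.
  by apply/polyP => i; rewrite coef_poly coef0 if_same.
by rewrite mul0r.
Qed.

Lemma has_gfD f f' W W' d :
  has_gf f W d -> has_gf f' W' d -> has_gf (fun k => f k + f' k) (W + W') d.
Proof.
move=> h h' N.
apply: eqmod_trans (eqmodD (h N) (h' N)); rewrite -mulrDl; apply: eqmodMl.
by move=> k hk; rewrite coefD !coef_trunc_series.
Qed.

Definition convolution (f f' : nat -> rat) n := \sum_(i < n.+1) f i * f' (n - i)%N.

Lemma has_gf_convolution f f' W W' d d' :
  has_gf f W d -> has_gf f' W' d' ->
  has_gf (convolution f f') (W * W') (d + d').
Proof.
move=> h h' N; apply: eqmod_trans (eqmodM (h N) (h' N)).
rewrite mulrACA -exprD; apply: eqmodMl => k hk.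
rewrite coef_trunc_series // coefM; apply: eq_bigr => i _.
by rewrite !coef_trunc_series //; move: (ltn_ord i); lia.
Qed.

(** With the value 0 before index 0, the generating series is multiplied by [1 - z]. Applied to the
    number of maps bounded by [k], it counts those with maximum exactly [k]. *)
Definition backward_diff (f : nat -> rat) k := f k - (if k is l.+1 then f l else 0).

Lemma has_gf_diff f W d : has_gf f W d.+1 -> has_gf (backward_diff f) W d.
Proof.
move=> h N; apply: eqmod_trans (h N); rewrite exprS mulrA; apply: eqmodMl.
move=> k hk; rewrite coef_trunc_series // mulrBr mulr1 coefB coefMX.
rewrite coef_trunc_series //; case: k hk => //= k hk.
by rewrite coef_trunc_series //; lia.
Qed.

Lemma has_gf_shift f W d : has_gf f W d ->
  has_gf (fun k => if k is l.+1 then f l else 0) ('X * W) d.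
Proof.
move=> h N; apply: eqmod_trans (eqmodM (fun _ _ => erefl) (h N)).
rewrite mulrA; apply: eqmodMl => k hk.
rewrite coef_trunc_series // coefXM; case: k hk => //= k hk.
by rewrite coef_trunc_series //; lia.
Qed.

Lemma has_gf_const1 : has_gf (fun=> 1) 1 1.
Proof.
move=> N k hk; rewrite expr1 mulrBr mulr1 coefB coefMX coef1.
by case: k hk => [|k] hk; rewrite !coef_trunc_series ?subr0 ?subrr //; lia.
Qed.

(** * Eulerian polynomials *)

(** Indexed so that [sum (n + 1)^d z^n = eulerian d / (1 - z)^(d + 1)]; the first values are 1, 1, 1
    + z, 1 + 4 z + z^2. *)
Fixpoint eulerian d : {poly rat} :=
  if d is e.+1
  then (1 + e%:R *: 'X) * eulerian e + 'X * (1 - 'X) * (eulerian e)^`()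
  else 1.

(** Multiplying the coefficient of [z^n] by [n + 1] is the operator [G + z G']; applied to
    [E / (1 - z)^(d + 1)] it produces the Eulerian recurrence. *)
Lemma has_gf_eulerian d : has_gf (fun n => (n.+1 ^ d)%:R) (eulerian d) d.+1.
Proof.
elim: d => [|d IH].
  by apply: has_gf_ext has_gf_const1 => n; rewrite expn0.
move=> N; set F := trunc_series _ N.
have {}IH := IH N; set G := trunc_series _ N in IH.
have FE : eqmod N F (G + 'X * G^`()).
  move=> k hk; rewrite coef_trunc_series // coefD coefXM coef_trunc_series //.
  case: k hk => [|k] hk /=; first by rewrite !exp1n addr0.
  rewrite coef_deriv coef_trunc_series // expnS natrM -[_ *+ k.+1]mulr_natr.
  by rewrite -[k.+2]add1n natrD; ring.
(* Differentiation loses one order of the congruence, and the factor ['X] gives it back. *)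
have D : eqmod N ('X * (G * (1 - 'X) ^+ d.+1)^`()) ('X * (eulerian d)^`()).
  move=> k hk; rewrite !coefXM; case: k hk => //= k hk.
  by rewrite !coef_deriv IH.
apply: (eqmod_trans (eqmodMl _ FE)).
have -> : eulerian d.+1 = (1 - 'X) * ('X * (eulerian d)^`()) +
  (1 - 'X + d.+1%:R *: 'X) * eulerian d.
  by rewrite /= -[d.+1]addn1 natrD scalerDl scale1r -!mul_polyC; ring.
have -> : (G + 'X * G^`()) * (1 - 'X) ^+ d.+2 =
  (1 - 'X) * ('X * (G * (1 - 'X) ^+ d.+1)^`()) +
  (1 - 'X + d.+1%:R *: 'X) * (G * (1 - 'X) ^+ d.+1).
  rewrite derivM deriv_exp derivB derivX derivC sub0r /= -mulr_natr -!mul_polyC.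
  by rewrite !exprS -polyC_natr; ring.
apply: eqmodD; apply: eqmodM => //.
Qed.

(** With [z^i (1 + z)^(e - 1)] taken out, what remains is [(i + 1) (1 + z)^2 + 2 e z], whose two
    terms have nonnegative coefficients. For [e = 0] the factor [2 e] kills the term with exponent
    [e.-1]. *)
Lemma eulerian_step_basis (r : rat) i e :
  let B := r *: ('X^i * (1 + 'X) ^+ e) in
  (1 + (i.*2 + e).+1%:R *: 'X) * B + 'X * (1 - 'X) * B^`() =
  (r * i.+1%:R) *: ('X^i * (1 + 'X) ^+ e.+1) +
  (r * (2 * e%:R)) *: ('X^(i.+1) * (1 + 'X) ^+ e.-1).
Proof.
rewrite /= derivZ derivM derivXn deriv_exp derivD derivX derivC add0r mul1r.
rewrite -[_ *+ i]mulr_natr -[_ *+ e]mulr_natr -!mul_polyC !polyCM !polyC_natr.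
rewrite -[(_ + _).+1%:R]natr1 natrD -muln2 natrM -[i.+1%:R]natr1.
by case: i e => [|i] [|e] /=; rewrite ?exprS; ring.
Qed.

Lemma gamma_pos_eulerianS d : gamma_pos d (eulerian d.+1).
Proof.
elim: d => [|d IH].
  have -> : eulerian 1 = 1 *: ('X^0 * (1 + 'X) ^+ (0 - 0.*2)).
    by rewrite /= derivC scale0r scale1r !expr0 !mulr1 mulr0 !addr0.
  exact: gamma_pos_basis.
move: IH; rewrite [eulerian d.+2]/= -/(eulerian d) -[_ + _ * (eulerian d)^`()]/(eulerian d.+1).
move: (eulerian d.+1) => p.
elim=> [|p1 p2 _ IH1 _ IH2|r i r0 ic].
- by rewrite mulr0 deriv0 mulr0 addr0; apply: gamma_pos0.
- by rewrite derivD mulrDr [X in _ + X]mulrDr addrACA; apply: gamma_posD.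
have [e ->] : exists e, d = (i.*2 + e)%N by exists (d - i.*2)%N; lia.
rewrite addKn eulerian_step_basis.
have -> : e.+1 = ((i.*2 + e).+1 - i.*2)%N by lia.
case: e => [|e]; first by rewrite !mulr0 scale0r addr0; apply: gamma_pos_basis; rewrite ?mulr_ge0 //; lia.
apply: gamma_posD; first by apply: gamma_pos_basis; rewrite ?mulr_ge0 //; lia.
have -> : e.+1.-1 = ((i.*2 + e.+1).+1 - i.+1.*2)%N by lia.
by apply: gamma_pos_basis; rewrite ?mulr_ge0 //; lia.
Qed.

Lemma has_gf_binomial d : has_gf (fun n => ('C(n + d, d))%:R) 1 d.+1.
Proof.
elim: d => [|d IH]; first by apply: has_gf_ext has_gf_const1 => n; rewrite bin0.
have := has_gf_convolution has_gf_const1 IH; rewrite mulr1 add1n.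
apply: has_gf_ext => n; rewrite /convolution.
under eq_bigr => i _ do rewrite mul1r.
rewrite (reindex_inj rev_ord_inj) /= -natr_sum; congr (_%:R).
under eq_bigr => i _ do rewrite subSS (subKn (ltnSE (ltn_ord i))).
elim: n => [|n IHn]; first by rewrite big_ord1 !add0n !binn.
by rewrite big_ord_recr /= IHn [in RHS]addSn binS addSnnS.
Qed.

(** The binomial series [B] inverts [(1 - z)^(d + 1)] modulo [z^(n + 1)], so [f] is read off from
    [W * B]. *)
Lemma has_gf_coef f W d n : has_gf f W d.+1 ->
  f n = \sum_(j < n.+1) W`_j * ('C(n - j + d, d))%:R.
Proof.
move=> h; have hf := h n.+1; have hb := @has_gf_binomial d n.+1.
set F := trunc_series f n.+1 in hf *; set B := trunc_series _ n.+1 in hb.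
have e : eqmod n.+1 F (W * B).
  move=> k hk; rewrite -(eqmodMl B hf) // mulrAC -mulrA.
  by rewrite (eqmodM (fun _ _ => erefl) hb) // mulr1.
have := e n (ltnSn n); rewrite coef_trunc_series // => ->.
rewrite coefM; apply: eq_bigr => j _; rewrite coef_trunc_series //.
by move: (ltn_ord j); lia.
Qed.

(** * Order-preserving maps of a two-coloured poset *)

Lemma card_ord_interval N i k : (k <= N)%N ->
  #|[pred v : 'I_N.+1 | (i <= v <= k)%N]| = (k.+1 - i)%N.
Proof.
move=> kN; rewrite -[RHS]muln1 -sum_nat_const_nat big_geq_mkord.
rewrite (big_ord_widen_cond N.+1 (fun v => (i <= v)%N) (fun=> 1%N)) //.
by rewrite sum1_card.
Qed.

Lemma neq_negb (c b : bool) : c != b -> c = ~~ b.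
Proof. by case: c b => -[]. Qed.

Lemma add_negb (b : bool) : (b + ~~ b = 1)%N.
Proof. by case: b. Qed.

Lemma negb_neq (b : bool) : ~~ b <> b.
Proof. by case: b. Qed.

Section TwoColouredOrder.
Variables (E : finType) (col : E -> bool) (cov : rel E).
Implicit Types (U T : {set E}) (g : E -> nat) (b : bool).
Hypothesis col_cov : forall p p', cov p p' -> col p' = ~~ col p.
Hypothesis cov_below : forall p', col p' -> exists p, cov p p'.

Definition down_closed (U : {set E}) :=
  forall p p', cov p p' -> p' \in U -> p \in U.

(* Relations into a coloured element are strict, the others are weak. *)
Definition order_ok (U : {set E}) (g : E -> nat) :=
  [forall p in U, forall p' in U, cov p p' ==> (g p + col p' <= g p')%N].

(** Order the elements by value and, at equal values, the coloured ones below the uncoloured ones: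
    [order_ok] says that [cov] is increasing for this order, and [top_run b] collects the elements
    of colour [b] above all those of the other colour. It is the last monochromatic run if that run
    has colour [b], and empty otherwise. *)
Definition top_run b (U : {set E}) (g : E -> nat) : {set E} :=
  [set y in U | (col y == b) &&
     [forall x in U, (col x == ~~ b) ==> (g x + b <= g y)%N]].

Lemma order_okP U g :
  reflect {in U &, forall p p', cov p p' -> (g p + col p' <= g p')%N}
          (order_ok U g).
Proof.
apply: (iffP forall_inP) => [h p p' pU p'U c|h p pU].
  by have /forall_inP/(_ _ p'U)/implyP/(_ c) := h _ pU.
by apply/forall_inP => p' p'U; apply/implyP; apply: h.
Qed.

Lemma top_runP b U g y :
  reflect [/\ y \in U, col y = b &
             {in U, forall x, col x = ~~ b -> (g x + b <= g y)%N}]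
          (y \in top_run b U g).
Proof.
rewrite inE; apply: (iffP and3P) => [[yU /eqP cy /forall_inP h]|[yU cy h]].
  by split=> // x xU cx; have /implyP := h _ xU; apply; apply/eqP.
split=> //; first exact/eqP.
by apply/forall_inP => x xU; apply/implyP => /eqP; apply: h.
Qed.

Lemma top_run_sub b U g y : y \in top_run b U g -> y \in U.
Proof. by case/top_runP. Qed.

Lemma top_run_col b U g y : y \in top_run b U g -> col y = b.
Proof. by case/top_runP. Qed.

Lemma not_top_run b U g y : y \in U -> col y = b -> y \notin top_run b U g ->
  exists x, [/\ x \in U, col x = ~~ b & (g y + ~~ b <= g x)%N].
Proof.
move=> yU cy; rewrite inE yU cy eqxx /= negb_forall.
case/existsP=> x; rewrite !negb_imply -ltnNge => /and3P[xU /eqP cx h].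
by exists x; split=> //; have := add_negb b; lia.
Qed.

Lemma eq_top_run b U g g' : {in U, g =1 g'} -> top_run b U g = top_run b U g'.
Proof.
move=> e; apply/setP => y; apply/top_runP/top_runP => -[yU cy h]; split=> // x xU cx.
  by rewrite -!e ?h.
by rewrite !e ?h.
Qed.

Lemma eq_order_ok U g g' : {in U, g =1 g'} -> order_ok U g = order_ok U g'.
Proof.
move=> e; apply/order_okP/order_okP => h p p' pU p'U c.
  by rewrite -!e ?h.
by rewrite !e ?h.
Qed.

Lemma order_ok_sub U U' g : U' \subset U -> order_ok U g -> order_ok U' g.
Proof.
move=> /subsetP s /order_okP h; apply/order_okP => p p' pU p'U.
by apply: h; apply: s.
Qed.

Lemma top_run_disj b U g y z :
  y \in top_run b U g -> z \in top_run (~~ b) U g -> False.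
Proof.
move=> /top_runP[yU cy hy] /top_runP[zU cz hz].
have := hy _ zU cz; have := hz _ yU; rewrite negbK cy => /(_ erefl).
by have := add_negb b; lia.
Qed.

(** Two nonempty top runs would bound each other with gaps adding up to 1. If the one of colour
    [~~ b] is empty, every element of that colour lies below one of colour [b], so a largest element
    of colour [b] is in the top run. *)
Lemma top_run_neg b U g : U != set0 ->
  (top_run (~~ b) U g == set0) = (top_run b U g != set0).
Proof.
case/set0Pn=> p pU; apply/idP/idP.
  move=> /eqP e0; apply/set0Pn.
  have [y yU ymax] : exists2 y, y \in U & {in U, forall x, g x <= g y}%N.
    by case: (arg_maxnP g pU) => y yU h; exists y => // x; apply: h.
  have : forall z, z \in U -> col z = ~~ b -> exists x, [/\ x \in U, col x = b & (g z + b <= g x)%N].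
    move=> z zU cz; have : z \notin top_run (~~ b) U g by rewrite e0 inE.
    by move/(not_top_run zU cz); rewrite negbK.
  move=> H.
  have [q [qU cq]] : exists q, q \in U /\ col q = b.
    case: (eqVneq (col y) b) => [|cy]; first by exists y.
    by have [|x [xU cx _]] := H y yU; [exact: neq_negb | exists x].
  have qP : (q \in U) && (col q == b) by rewrite qU cq eqxx.
  case: (@arg_maxnP _ q (fun z => (z \in U) && (col z == b)) g qP) => z /andP[zU /eqP cz] zmax; exists z.
  apply/top_runP; split=> // x xU cx; have [w [wU cw h]] := H _ xU cx.
  by apply: leq_trans h (zmax _ _); rewrite wU cw eqxx.
case/set0Pn=> y yT; apply/eqP/setP => z; rewrite [in RHS]inE.
by apply/negbTE/negP; apply: top_run_disj yT.
Qed.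

Lemma top_run_eq0 b U g : U != set0 ->
  (top_run b U g == set0) = ((top_run false U g == set0) == ~~ b).
Proof.
move=> U0; case: b => /=; last by rewrite eqb_id.
by rewrite (top_run_neg false g U0); case: eqP.
Qed.

(** The situation is contradictory: the top run gives [g p' + b <= g p] and the relation gives
    [g p + ~~ b <= g p']. Thus nothing in [U] covers an element of the top run. *)
Lemma cov_not_top b U g p p' : order_ok U g -> cov p p' ->
  p \in top_run b U g -> p' \in U -> p' \in top_run b U g.
Proof.
move=> /order_okP ok c pT p'U.
have /top_runP[pU cp h] := pT.
have cp' : col p' = ~~ b by rewrite (col_cov c) cp.
have := ok _ _ pU p'U c; have := h _ p'U cp'; rewrite cp'.
by have := add_negb b; lia.
Qed.

Lemma down_closedD b U g : down_closed U -> order_ok U g ->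
  down_closed (U :\: top_run b U g).
Proof.
move=> dU ok p p' c /setDP[p'U p'T]; apply/setDP; split; first exact: dU c p'U.
by apply: contra p'T => pT; apply: cov_not_top ok c pT p'U.
Qed.

(** An element of colour [b] outside the run is below some [x] of the other colour, which is itself
    below the run; the gaps [~~ b] and [b] add up to 1. *)
Lemma below_top_run b U g p t : p \in U :\: top_run b U g ->
  t \in top_run b U g -> (g p + b <= g t)%N.
Proof.
move=> /setDP[pU pT] /top_runP[tU ct h].
case: (eqVneq (col p) b) => [cp|cp]; last by apply: h => //; apply: neq_negb.
have [x [xU cx hx]] := not_top_run pU cp pT.
by have := h _ xU cx; have := add_negb b; lia.
Qed.

(** An element of colour [b] left over lies below one of the other colour that is left as well, so
    the next run has the other colour. If nothing is left, [b] is false, since a coloured element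
    has one of the other colour below it in [U]. *)
Lemma next_run_colour b U g : down_closed U -> order_ok U g ->
  top_run b U g != set0 ->
  (top_run false (U :\: top_run b U g) g == set0) = ~~ b.
Proof.
move=> dU ok T0; set T := top_run b U g; set U' := U :\: T.
have key z : z \in U' -> col z = b -> exists x, [/\ x \in U', col x = ~~ b & (g z + ~~ b <= g x)%N].
  move=> /setDP[zU zT] cz; have [x [xU cx hx]] := not_top_run zU cz zT.
  exists x; split=> //; apply/setDP; split=> //; apply/negP => /top_run_col.
  by rewrite cx; apply: negb_neq.
case: (eqVneq U' set0) => [U'0|U'n0]; last first.
  have Tb0 : top_run b U' g = set0.
    apply/setP=> z; rewrite [RHS]inE; apply/negbTE/negP => /top_runP[zU' cz h].
    have [x [xU' cx hx]] := key _ zU' cz.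
    by have := h _ xU' cx; have := add_negb b; lia.
  by move: Tb0 => /eqP; rewrite (top_run_eq0 b g U'n0) => /eqP.
have UT : U = T.
  apply/eqP; rewrite eqEsubset -setD_eq0 -/U' U'0 eqxx /=.
  by apply/subsetP => y /top_run_sub.
have -> : top_run false U' g = set0.
  apply/setP => y; rewrite [RHS]inE; apply/negbTE/negP => /top_run_sub.
  by rewrite U'0 inE.
have [y yT] := set0Pn _ T0.
rewrite eqxx; apply/esym/negP => bT.
have cy : col y by rewrite (top_run_col yT).
have [x c] := cov_below cy.
have xT : x \in T by rewrite -UT; apply: dU c _; rewrite UT.
by have := col_cov c; rewrite (top_run_col yT) (top_run_col xT) bT.
Qed.

(** The top colour prescribed for [U :\: T] prevents [T] from merging with a run of its own colour
    just below it. *)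
Lemma top_run_glue b (U T : {set E}) g :
  T \subset U -> {in T, forall t, col t = b} ->
  {in U :\: T & T, forall p t, g p + b <= g t}%N ->
  (top_run false (U :\: T) g == set0) = ~~ b ->
  top_run b U g = T.
Proof.
move=> /subsetP TU Tb h hb; apply/setP => y; apply/idP/idP.
  case/top_runP=> yU cy hy; apply/negPn/negP => yT.
  have yU' : y \in U :\: T by apply/setDP.
  have : y \notin top_run b (U :\: T) g.
    have n0 : U :\: T != set0 by apply/set0Pn; exists y.
    by have := top_run_eq0 b g n0; rewrite hb eqxx => /eqP ->; rewrite inE.
  case/(not_top_run yU' cy) => x [/setDP[xU _] cx hx].
  by have := hy _ xU cx; have := add_negb b; lia.
move=> yT; apply/top_runP; split; [exact: TU | exact: Tb |] => x xU cx.
apply: h => //; apply/setDP; split=> //; apply/negP => /Tb.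
by rewrite cx; apply: negb_neq.
Qed.

Lemma order_ok_glue b (U T : {set E}) g :
  {in T, forall t, col t = b} ->
  {in U :\: T & T, forall p t, g p + b <= g t}%N ->
  down_closed (U :\: T) -> order_ok (U :\: T) g -> order_ok U g.
Proof.
move=> Tb h dU' /order_okP ok; apply/order_okP => p p' pU p'U c.
case: (boolP (p' \in T)) => p'T; last first.
  have p'U' : p' \in U :\: T by apply/setDP.
  by apply: ok => //; apply: dU' c p'U'.
rewrite (Tb _ p'T); apply: h => //; apply/setDP; split=> //; apply/negP => pT.
by have := col_cov c; rewrite (Tb _ pT) (Tb _ p'T) => /esym /negb_neq.
Qed.

(* Functions on [U] are extended by 0 outside [U]; the bound [N] only serves to make the
   ambient function type finite. *)
Definition supp_fun N (U : {set E}) k (g : {ffun E -> 'I_N.+1}) :=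
  [forall p, (g p <= if p \in U then k else 0)%N].

(** The colour of the top run is stored as the emptiness of the uncoloured one. Empty [U] thereby
    has the colour true only, which forces the lowest run to be uncoloured. *)
Definition order_maps N (c : bool) (U : {set E}) k : {set {ffun E -> 'I_N.+1}} :=
  [set g | [&& supp_fun U k g, order_ok U (fun p => g p) &
              (top_run false U (fun p => g p) == set0) == c]].

Definition restr N (A : {set E}) (g : {ffun E -> 'I_N.+1}) : {ffun E -> 'I_N.+1} :=
  [ffun p => if p \in A then g p else ord0].

Lemma supp_funP N U k (g : {ffun E -> 'I_N.+1}) :
  reflect ({in U, forall p, g p <= k}%N /\ forall p, p \notin U -> g p = ord0)
          (supp_fun U k g).
Proof.
apply: (iffP forallP) => [h|[h h'] p].
  split=> p pU; first by have := h p; rewrite pU.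
  by apply: val_inj => /=; apply/eqP; rewrite -leqn0; have := h p; rewrite (negbTE pU).
by case: ifP => [/h//|/negbT/h' ->].
Qed.

(** * Counting order maps by their top run *)

Definition max_value N (g : {ffun E -> 'I_N.+1}) := (\max_p g p)%N.

Lemma order_maps_bound N c U k l (g : {ffun E -> 'I_N.+1}) : (l <= k)%N ->
  (g \in order_maps N c U l) = (g \in order_maps N c U k) && (max_value g <= l)%N.
Proof.
move=> lk; rewrite !inE andbAC; congr (_ && _).
apply/supp_funP/andP => [[h1 h2]|[/supp_funP[h1 h2] /bigmax_leqP h]].
  split; first by apply/supp_funP; split=> // p pU; apply: leq_trans (h1 _ pU) lk.
  apply/bigmax_leqP => p _; case: (boolP (p \in U)) => [/h1//|/h2 ->//].
by split=> // p _; apply: h.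
Qed.

Lemma card_order_maps_max N c U k l : (l <= k)%N ->
  (#|[set g in order_maps N c U k | max_value g == l]|%:R : rat) =
  backward_diff (fun l => #|order_maps N c U l|%:R) l.
Proof.
move=> lk; rewrite /backward_diff; case: l lk => [|l] lk.
  rewrite subr0; congr (_%:R); apply: eq_card => g.
  by rewrite inE (order_maps_bound c U g lk) leqn0.
have lk' := ltnW lk; have s : order_maps N c U l \subset order_maps N c U l.+1.
  apply/subsetP => g; rewrite (order_maps_bound c U g lk') (order_maps_bound c U g lk).
  by case/andP=> -> /leqW.
rewrite -natrB ?subset_leq_card // -(cardsID (order_maps N c U l) (order_maps N c U l.+1)).
rewrite (setIidPr s) addKn; congr (_%:R); apply: eq_card => g.
rewrite !inE -[_ && (_ && _)]/(_ && _) -/(supp_fun U k g).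
have := order_maps_bound c U g lk'; have := order_maps_bound c U g lk.
rewrite !inE => -> ->; case: (boolP [&& _, _ & _]) => //= _.
by rewrite -ltnNge eqn_leq andbC.
Qed.

Lemma restrE N (A : {set E}) (g : {ffun E -> 'I_N.+1}) p :
  p \in A -> restr A g p = g p.
Proof. by move=> pA; rewrite ffunE pA. Qed.

(** Conditions on a top run that do not mention the map. The last one expresses that the lowest run
    is uncoloured. *)
Definition top_run_candidate b U T :=
  [&& T != set0, T \subset U, [forall t in T, col t == b],
      [forall p, forall p', cov p p' ==> (p' \in U :\: T) ==> (p \in U :\: T)]
    & b ==> (U :\: T != set0)].

Lemma top_run_is_candidate b U g : down_closed U -> order_ok U g ->
  top_run b U g != set0 -> top_run_candidate b U (top_run b U g).
Proof.
move=> dU ok T0; apply/and5P; split=> //.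
- by apply/subsetP => p /top_run_sub.
- by apply/forall_inP => t /top_run_col ->.
- apply/forallP => p; apply/forallP => p'; apply/implyP => c; apply/implyP.
  exact: down_closedD c.
apply/implyP => bT; have [y yT] := set0Pn _ T0.
have cy : col y by rewrite (top_run_col yT).
have [x c] := cov_below cy; apply/set0Pn; exists x; apply/setDP; split.
  by apply: dU c (top_run_sub yT).
by apply/negP => xT; have := col_cov c; rewrite (top_run_col yT) (top_run_col xT) bT.
Qed.

Lemma max_value_leq N b U c k (g : {ffun E -> 'I_N.+1}) v :
  g \in order_maps N c U k -> (U = set0 -> b = false) ->
  {in U, forall p, g p + b <= v}%N -> (max_value g + b <= v)%N.
Proof.
rewrite inE => /and3P[/supp_funP[_ h0] _ _] b0 h.
case: (eqVneq U set0) => [U0|/set0Pn[q qU]].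
  rewrite (b0 U0) addn0; apply/bigmax_leqP => p _.
  by rewrite h0 // U0 inE.
have bv : (b <= v)%N by have := h _ qU; lia.
rewrite addnC -leq_subRL //; apply/bigmax_leqP => p _; rewrite leq_subRL // addnC.
by case: (boolP (p \in U)) => pU; [apply: h | rewrite h0].
Qed.

(** Elements of [T] have one colour, so [cov] does not relate them, and every condition linking them
    to the rest follows from lying at least [b] above its maximum. The fibre is thus a product of
    intervals over [T]. *)
Lemma top_run_fibre N b U T k (g' g : {ffun E -> 'I_N.+1}) :
  top_run_candidate b U T -> g' \in order_maps N (~~ b) (U :\: T) k ->
  [&& supp_fun U k g, order_ok U (fun p => g p),
      top_run b U (fun p => g p) == T & restr (U :\: T) g == g'] =
  [forall p, if p \in T then (max_value g' + b <= g p <= k)%N else g p == g' p].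
Proof.
move=> /and5P[T0 /subsetP TU /forall_inP Tb /forallP dU' b0] g'U'.
have b0' : U :\: T = set0 -> b = false.
  by move=> e; apply/negbTE/negP => /(implyP b0); rewrite e eqxx.
have [/supp_funP[h1 h2] ok' top'] := and3P (eq_ind _ is_true g'U' _ (in_set _ _)).
apply/and4P/forallP => [[/supp_funP[s1 s2] ok /eqP tT /eqP eg] p|h].
  have eg' q : g' q = if q \in U :\: T then g q else ord0 by rewrite -eg ffunE.
  case: ifP => [pT|/negbT pT].
    rewrite s1 ?TU // andbT; apply: max_value_leq g'U' b0' _ => q qU'.
    rewrite eg' qU'; move: qU' pT; rewrite -tT.
    exact: (@below_top_run b U (fun p => g p : nat)).
  apply/eqP; rewrite eg' inE pT /=; case: ifP => // /negbT pU.
  exact: s2.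
have hT p : p \in T -> (max_value g' + b <= g p <= k)%N by move=> pT; have := h p; rewrite pT.
have hN p : p \notin T -> g p = g' p by move=> pT; have := h p; rewrite (negbTE pT) => /eqP.
have gU' : {in U :\: T, (fun p => g p : nat) =1 (fun p => g' p : nat)}.
  by move=> p /setDP[_ /hN ->].
have below : {in U :\: T & T, forall p t, g p + b <= g t}%N.
  move=> p t /setDP[_ pT] /hT/andP[ht _]; apply: leq_trans ht; rewrite leq_add2r hN //.
  by rewrite /max_value (leq_bigmax (F := fun p => g' p : nat)).
have Tb' : {in T, forall t, col t = b} by move=> t /Tb/eqP.
have d' : down_closed (U :\: T).
  move=> p p' c p'U; have /forallP/(_ p') := dU' p.
  by rewrite c p'U.
split.
- apply/supp_funP; split=> p pU.
    case: (boolP (p \in T)) => [/hT/andP[]//|pT]; rewrite hN //; apply: h1.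
    exact/setDP.
  rewrite hN; last by apply: contra pU => /TU.
  by apply: h2; rewrite inE negb_and pU orbT.
- apply: order_ok_glue Tb' below d' _; by rewrite (eq_order_ok gU').
- apply/eqP; apply: top_run_glue => //; first exact/subsetP.
  by rewrite (eq_top_run _ gU') (eqP top').
apply/eqP/ffunP => p; rewrite ffunE; case: ifP => [/setDP[_ /hN]//|/negbT pU].
by rewrite h2.
Qed.

Lemma card_top_run_fibre N b U T k (g' : {ffun E -> 'I_N.+1}) : (k <= N)%N ->
  top_run_candidate b U T -> g' \in order_maps N (~~ b) (U :\: T) k ->
  #|[set g : {ffun E -> 'I_N.+1} |
      [&& supp_fun U k g, order_ok U (fun p => g p),
      top_run b U (fun p => g p) == T & restr (U :\: T) g == g']]| =
  ((k.+1 - max_value g' - b) ^ #|T|)%N.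
Proof.
move=> kN cT g'U'.
pose F p := if p \in T then [pred v : 'I_N.+1 | (max_value g' + b <= v <= k)%N]
            else pred1 (g' p).
have -> : #|[set g : {ffun E -> 'I_N.+1} |
      [&& supp_fun U k g, order_ok U (fun p => g p),
      top_run b U (fun p => g p) == T & restr (U :\: T) g == g']]| = #|family F|.
  apply: eq_card => g; rewrite inE (top_run_fibre _ cT g'U').
  apply/forallP/familyP => h p; have := h p; rewrite /F; case: ifP => //.
rewrite card_family foldrE big_image /= (bigID (mem T)) /=.
rewrite (eq_bigr (fun=> (k.+1 - max_value g' - b)%N)) => [|p pT]; last first.
  by rewrite /F pT card_ord_interval // subnDA.
rewrite prod_nat_const [X in (_ * X)%N]big1 ?muln1 // => p pT.
by rewrite /F (negbTE pT) card1.
Qed.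

Lemma restr_order_maps N b U T k (g : {ffun E -> 'I_N.+1}) :
  top_run_candidate b U T -> down_closed U ->
  g \in order_maps N b U k -> top_run b U (fun p => g p) = T ->
  restr (U :\: T) g \in order_maps N (~~ b) (U :\: T) k.
Proof.
move=> /and5P[T0 _ _ _ _] dU; rewrite !inE => /and3P[/supp_funP[s1 s2] ok _] tT.
have e : {in U :\: T, (fun p => restr (U :\: T) g p : nat) =1 (fun p => g p : nat)}.
  by move=> p pU; rewrite restrE.
apply/and3P; split.
- apply/supp_funP; split=> p pU; last by rewrite ffunE (negbTE pU).
  by rewrite e //; apply: s1; case/setDP: pU.
- by rewrite (eq_order_ok e); apply: order_ok_sub ok; apply: subsetDl.
by rewrite (eq_top_run _ e) -tT (@next_run_colour b U (fun p => g p : nat)) ?tT.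
Qed.

(** Summing the fibre sizes over the maps on [U :\: T], grouped by their maximum [l], gives a
    convolution with shifted powers. *)
Lemma card_top_run N b U T k : (k <= N)%N -> down_closed U ->
  top_run_candidate b U T ->
  #|[set g in order_maps N b U k | top_run b U (fun p => g p) == T]| =
  (\sum_(l < k.+1) #|[set g in order_maps N (~~ b) (U :\: T) k | max_value g == l]| *
    (k.+1 - l - b) ^ #|T|)%N.
Proof.
move=> kN dU cT; have /and5P[T0 TU _ _ _] := cT.
have U0 : U != set0 by apply: contraNneq T0 => U0; rewrite -subset0 -U0.
set A := order_maps N (~~ b) (U :\: T) k.
rewrite -sum1_card (partition_big (restr (U :\: T)) (mem A)) /=; last first.
  by move=> g; rewrite inE => /andP[gU /eqP]; apply: restr_order_maps.
transitivity (\sum_(g' in A) (k.+1 - max_value g' - b) ^ #|T|)%N.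
  apply: eq_bigr => g' g'A; rewrite -(card_top_run_fibre kN cT g'A) -sum1_card.
  apply: eq_bigl => g; rewrite !inE -!andbA; case: (supp_fun U k g) => //=.
  case: (order_ok _ _) => //=; case: (top_run b U _ =P T) => [tT|]; rewrite ?andbF //=.
  have := top_run_eq0 b (fun p => g p : nat) U0; rewrite tT (negbTE T0) => /esym.
  by move/negbT/neq_negb; rewrite negbK => ->; rewrite eqxx.
pose h (g' : {ffun E -> 'I_N.+1}) : 'I_k.+1 := inord (max_value g').
rewrite (partition_big h xpredT) //=; apply: eq_bigr => l _.
rewrite -sum_nat_const big_mkcond [in RHS]big_mkcond /=; apply: eq_bigr => g' _.
have -> : (g' \in [set g in A | max_value g == l]) = (g' \in A) && (max_value g' == l).
  by rewrite [LHS]inE.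
case: (boolP (g' \in A)) => //= g'A.
have hb : (max_value g' <= k)%N.
  by move: g'A; rewrite /A (order_maps_bound _ _ _ (leqnn k)) => /andP[].
have -> : (h g' == l) = (max_value g' == l) by rewrite -(inj_eq val_inj) /= inordK ?ltnS.
by case: (max_value g' =P l) => [->|].
Qed.

Lemma card_order_maps N b U k : (k <= N)%N -> down_closed U -> U != set0 ->
  #|order_maps N b U k| =
  (\sum_(T | top_run_candidate b U T)
    #|[set g in order_maps N b U k | top_run b U (fun p => g p) == T]|)%N.
Proof.
move=> kN dU U0; rewrite -sum1_card.
rewrite (partition_big (fun g : {ffun E -> 'I_N.+1} => top_run b U (fun p => g p))
  (top_run_candidate b U)) /=.
  by apply: eq_bigr => T _; rewrite -sum1_card; apply: eq_bigl => g; rewrite inE.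
move=> g; rewrite inE => /and3P[_ ok c]; apply: top_run_is_candidate => //.
by rewrite top_run_eq0 // (eqP c); case: b {c}.
Qed.

Lemma card_order_maps0 N c k : #|order_maps N c set0 k| = c.
Proof.
have -> : order_maps N c set0 k = if c then [set [ffun=> ord0]] else set0.
  apply/setP => g; rewrite inE.
  have -> : top_run false set0 (fun p => g p) = set0.
    by apply/setP=> p; rewrite !inE.
  rewrite eqxx; case: c; last by rewrite !andbF inE.
  rewrite inE andbT; apply/andP/eqP => [[/supp_funP[_ h] _]|->].
    by apply/ffunP => p; rewrite h ?inE ?ffunE.
  split; first by apply/supp_funP; split=> p; rewrite ?inE ?ffunE.
  by apply/order_okP => p p'; rewrite inE.
by case: c; rewrite ?cards1 ?cards0.
Qed.

(* [F N k] does not depend on [N >= k] and has generating series W / (1 - z)^d with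
   W gamma-positive of centre c / 2. *)
Definition gamma_counted (F : nat -> nat -> nat) d c :=
  exists (f : nat -> rat) W,
    [/\ forall N k, (k <= N)%N -> (F N k)%:R = f k, has_gf f W d & gamma_pos c W].

Lemma gamma_counted_sum (I : finType) (P : pred I) (F : I -> nat -> nat -> nat) d c :
  (forall i, P i -> gamma_counted (F i) d c) ->
  gamma_counted (fun N k => \sum_(i | P i) F i N k)%N d c.
Proof.
move=> h; rewrite /gamma_counted.
elim: (index_enum I) => [|i r [f [W [h1 h2 h3]]]].
  exists (fun=> 0), 0; split=> [N k _||]; first by rewrite big_nil.
    exact: has_gf0.
  exact: gamma_pos0.
case: (boolP (P i)) => Pi; last first.
  by exists f, W; split=> // N k kN; rewrite big_cons (negbTE Pi) h1.
have [f' [W' [h1' h2' h3']]] := h _ Pi.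
exists (fun k => f' k + f k), (W' + W); split.
- by move=> N k kN; rewrite big_cons Pi natrD h1 // h1'.
- exact: has_gfD.
exact: gamma_posD.
Qed.

(** A strict step delays the powers by one index. The new initial term is [0 ^ t], which vanishes
    for [t > 0]. *)
Lemma has_gf_shifted_eulerian (b : bool) t : (0 < t)%N ->
  has_gf (fun n => ((n.+1 - b) ^ t)%:R) ('X^b * eulerian t) t.+1.
Proof.
case: b => t0; last by rewrite mul1r; apply: has_gf_ext (has_gf_eulerian t) => n; rewrite subn0.
apply: has_gf_ext (has_gf_shift (has_gf_eulerian t)) => -[|n] //=.
by rewrite subnn exp0n.
Qed.

(* Peeling off the top run [T] multiplies the numerator by z^b times the Eulerian
   polynomial of [T]; the factor z of the strict steps makes up for the degree lost by
   the Eulerian polynomials, so the centre depends only on [U] and [b]. *)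
Lemma gamma_counted_order_maps U b : down_closed U ->
  gamma_counted (fun N k => #|order_maps N b U k|) #|U|.+1 (if b then #|U| else #|U|.-1).
Proof.
have [n] := ubnP #|U|; elim: n U b => // n IH U b Un dU.
case: (eqVneq U set0) => [->|U0].
  exists (fun=> b%:R), b%:R%:P; rewrite cards0; split.
  - by move=> N k _; rewrite card_order_maps0.
  - case: b; last exact: has_gf0.
    exact: has_gf_const1.
  case: b; last exact: gamma_pos0.
  have := @gamma_pos_basis 0 1 0 ler01 isT.
  by rewrite scale1r expr0 mul1r expr0.
have [f [W [h1 h2 h3]]] : gamma_counted
    (fun N k => \sum_(T | top_run_candidate b U T)
      (if (k <= N)%N then #|[set g in order_maps N b U k | top_run b U (fun p => g p) == T]|
       else 0))%N #|U|.+1 (if b then #|U| else #|U|.-1).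
  apply: gamma_counted_sum => T cT.
  have /and5P[T0 TU _ /forallP dT bT] := cT.
  have T0' : (0 < #|T|)%N by rewrite card_gt0.
  have cU : #|U| = (#|U :\: T| + #|T|)%N by rewrite cardsD (setIidPr TU) subnK // subset_leq_card.
  have d' : down_closed (U :\: T).
    by move=> p p' c p'U; have /forallP/(_ p') := dT p; rewrite c p'U.
  have [|f [W [h1 h2 h3]]] := IH (U :\: T) (~~ b) _ d'; first by lia.
  exists (convolution (backward_diff f) (fun n => ((n.+1 - b) ^ #|T|)%:R)).
  exists (W * ('X^b * eulerian #|T|)); split.
  - move=> N k kN; rewrite kN card_top_run // /convolution natr_sum.
    apply: eq_bigr => l _; rewrite natrM; congr (_ * _); last first.
      by congr ((_ ^ _)%:R); move: (ltn_ord l); lia.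
    rewrite card_order_maps_max -1?ltnS // /backward_diff.
    case: (nat_of_ord l) (ltn_ord l) => [|l'] hl; rewrite !h1 //; lia.
  - rewrite cU -addnS; apply: has_gf_convolution; first exact: has_gf_diff.
    exact: has_gf_shifted_eulerian.
  have e : #|T| = #|T|.-1.+1 by lia.
  have ge : gamma_pos #|T|.-1 (eulerian #|T|) by rewrite {2}e; apply: gamma_pos_eulerianS.
  case: b {IH Un h1 h2 cT} bT h3 => bT h3; last first.
    rewrite mul1r; have -> : (#|U|.-1 = #|U :\: T| + #|T|.-1)%N by lia.
    exact: gamma_posM.
  have U'0 : (0 < #|U :\: T|)%N by rewrite card_gt0.
  (* The factor ['X] is gamma-positive with [c = 2], which makes up for both predecessors. *)
  have -> : (#|U| = #|U :\: T|.-1 + (2 + #|T|.-1))%N by lia.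
  apply: gamma_posM => //; apply: gamma_posM => //.
  have := @gamma_pos_basis 2 1 1 ler01 isT.
  by rewrite scale1r expr0 mulr1.
exists f, W; split=> // N k kN; rewrite -(h1 N k kN) card_order_maps //; congr (_%:R).
by apply: eq_bigr => T _; rewrite kN.
Qed.

(** Every uncoloured element is covered by another, and nothing covers a member of the top run, so
    the top run of the whole poset is coloured. All order maps are thus counted with [b = true],
    where the centre is [#|E| / 2]. *)
Lemma order_map_gf : (forall p, ~~ col p -> exists p', cov p p') ->
  exists (f : nat -> rat) W,
    [/\ forall N, #|[set g : {ffun E -> 'I_N.+1} |
                     order_ok [set: E] (fun p => g p)]|%:R = f N,
        has_gf f W #|E|.+1 & gamma_pos #|E| W].
Proof.
move=> above; have dT : down_closed [set: E] by move=> *; rewrite inE.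
have [f [W]] := gamma_counted_order_maps true dT.
rewrite cardsT => -[h1 h2 h3]; exists f, W; split=> // N.
rewrite -(h1 N N (leqnn N)); congr (_%:R); apply: eq_card => g; rewrite !inE.
have -> : supp_fun [set: E] N g.
  by apply/supp_funP; split=> p; rewrite ?inE // => _; rewrite -ltnS.
case: (boolP (order_ok _ _)) => //= ok; rewrite eqb_id; apply/esym/eqP/setP => x.
rewrite [RHS]inE; apply/negbTE/negP => xT.
have [|y c] := above x; first by rewrite (top_run_col xT).
have yT : y \in [set: E] by rewrite inE.
have := cov_not_top ok c xT yT => /top_run_col cy.
by have := col_cov c; rewrite cy (top_run_col xT).
Qed.

End TwoColouredOrder.

(** * The zigzag of chains *)

Section PathBlocks.
Variables (m' a' : nat).
Let m := m'.+2.
Let a := a'.+1.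
Let E : finType := ('I_m * 'I_a)%type.

(** Parity of the rank, which is [j] in an even block and [2 a - 1 - j] in an odd one. *)
Definition block_col (p : E) := odd (p.1 + p.2).

(* The zigzag poset whose element i is replaced by a chain of length a; the chains of
   the odd blocks are listed from the top. *)
Definition block_cov (p p' : E) :=
  [|| [&& p.1 == p'.1, ~~ odd p.1 & p'.2 == p.2.+1 :> nat],
      [&& p.1 == p'.1, odd p.1 & p.2 == p'.2.+1 :> nat]
    | [&& p.2 == ord_max, p'.2 == ord_max, ~~ odd p.1, odd p'.1
        & (p'.1 == p.1.+1 :> nat) || (p.1 == p'.1.+1 :> nat)]].

Lemma block_col_cov p p' : block_cov p p' -> block_col p' = ~~ block_col p.
Proof.
rewrite /block_cov /block_col !oddD.
case/or3P=> [/and3P[/eqP -> _ /eqP ->]|/and3P[/eqP -> _ /eqP ->]|].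
- by rewrite /= addbN.
- by rewrite /= addbN negbK.
by case/and5P=> /eqP -> /eqP -> /negbTE -> -> _; rewrite addFb addTb.
Qed.

Lemma block_neighbour (i : 'I_m) :
  exists i' : 'I_m, (i' == i.+1 :> nat) || (i == i'.+1 :> nat).
Proof.
case: i => -[|i] hi; first by exists (Ordinal (isT : (1 < m)%N)).
by exists (Ordinal (ltnW hi)); rewrite /= eqxx orbT.
Qed.

Lemma block_neighbour_odd (i i' : 'I_m) :
  (i' == i.+1 :> nat) || (i == i'.+1 :> nat) -> odd i' = ~~ odd i.
Proof. by case/orP=> /eqP -> /=; rewrite ?negbK. Qed.

(** Only the first elements of the even blocks have nothing below them, and their rank is 0. *)
Lemma block_cov_below p' : block_col p' -> exists p, block_cov p p'.
Proof.
case: p' => i [j hj]; rewrite /block_col /= oddD.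
case: (boolP (odd i)) => oi /=.
  move=> oj; have [ja|ja] := ltnP j a'.
    by exists (i, Ordinal (ja : (j.+1 < a)%N)); rewrite /block_cov /= eqxx oi eqxx.
  have [i' hi'] := block_neighbour i; exists (i', ord_max).
  have oi' := block_neighbour_odd hi'; rewrite orbC in hi'.
  rewrite /block_cov /= eqxx oi oi' oi /= hi'.
  by rewrite (_ : Ordinal hj == ord_max) ?orbT // -val_eqE /=; move: hj ja; rewrite /a; lia.
case: j hj => [|j] hj //= _.
by exists (i, Ordinal (ltnW hj)); rewrite /block_cov /= !eqxx oi.
Qed.

Lemma block_cov_above p : ~~ block_col p -> exists p', block_cov p p'.
Proof.
case: p => i [j hj]; rewrite /block_col /= oddD.
case: (boolP (odd i)) => oi /=.
  rewrite negbK; case: j hj => [|j] hj //= _.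
  by exists (i, Ordinal (ltnW hj)); rewrite /block_cov /= !eqxx oi orbT.
move=> oj; have [ja|ja] := ltnP j a'.
  by exists (i, Ordinal (ja : (j.+1 < a)%N)); rewrite /block_cov /= eqxx oi eqxx.
have [i' hi'] := block_neighbour i; exists (i', ord_max).
rewrite /block_cov /= eqxx oi (block_neighbour_odd hi') oi /= hi'.
by rewrite (_ : Ordinal hj == ord_max) ?orbT // -val_eqE /=; move: hj ja; rewrite /a; lia.
Qed.

Definition flip n (g : {ffun E -> 'I_n.+1}) : {ffun E -> 'I_n.+1} :=
  [ffun p : E => if odd p.1 then rev_ord (g p) else g p].

Lemma flipK n : involutive (@flip n).
Proof.
by move=> g; apply/ffunP => p; rewrite !ffunE; case: (odd p.1); rewrite ?rev_ordK.
Qed.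

(* The condition on order maps after flipping the odd blocks upside down. *)
Definition block_maps n : {set {ffun E -> 'I_n.+1}} :=
  [set s : {ffun E -> 'I_n.+1} | [forall i : 'I_m, forall j : 'I_a, forall j' : 'I_a,
              (j' == j.+1 :> nat) ==> (s (i, j) + odd j' <= s (i, j'))%N] &&
           [forall i : 'I_m, forall i' : 'I_m, (i' == i.+1 :> nat) ==>
              (s (i, ord_max) + s (i', ord_max) + odd a <= n)%N]].

Lemma block_mapsP n (s : {ffun E -> 'I_n.+1}) :
  reflect ((forall (i : 'I_m) (j j' : 'I_a), j' = j.+1 :> nat -> (s (i, j) + odd j' <= s (i, j'))%N) /\
           (forall i i' : 'I_m, i' = i.+1 :> nat ->
              (s (i, ord_max) + s (i', ord_max) + odd a <= n)%N))
          (s \in block_maps n).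
Proof.
rewrite inE; apply: (iffP andP) => -[h1 h2]; split.
- move=> i j j' e; have /forallP/(_ j)/forallP/(_ j')/implyP := forallP h1 i.
  by apply; apply/eqP.
- move=> i i' e; have /forallP/(_ i')/implyP := forallP h2 i.
  by apply; apply/eqP.
- by apply/forallP => i; apply/forallP => j; apply/forallP => j'; apply/implyP => /eqP; apply: h1.
by apply/forallP => i; apply/forallP => i'; apply/implyP => /eqP; apply: h2.
Qed.

(** For last elements of adjacent blocks, [i] even and [i'] odd, the relation
    [g (i, _) + odd a <= g (i', _)] becomes a bound on a sum, since flipping replaces [g (i', _)] by
    [n - g (i', _)]. Here [odd a] is the colour of the last element of an odd block. *)
Lemma flip_block_maps n (g : {ffun E -> 'I_n.+1}) :
  (flip g \in block_maps n) =
  order_ok block_col block_cov [set: E] (fun p => g p).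
Proof.
apply/block_mapsP/order_okP => [[h1 h2] p p' _ _|h].
  case: p p' => i j [i' j']; rewrite /block_cov /block_col /=.
  case/or3P=> [/and3P[/eqP <- oi /eqP e]|/and3P[/eqP <- oi /eqP e]|].
  - have := h1 i _ _ e; rewrite !ffunE /= (negbTE oi) e oddD /= (negbTE oi).
    by [].
  - have := h1 i _ _ e; rewrite !ffunE /= oi e oddD /= oi /=.
    by case: (g (i, j)) (g (i, j')) => u hu [v hv] /=; lia.
  case/and5P=> /eqP -> /eqP -> oi oi' /orP[]/eqP e; have := h2 _ _ e;
    rewrite !ffunE /= (negbTE oi) oi' oddD oi' /a /=;
    by case: (g (i, ord_max)) (g (i', ord_max)) => u hu [v hv] /=; lia.
split=> [i j j' e|i i' e].
  rewrite !ffunE /=; case: (boolP (odd i)) => oi.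
    have := h (i, j') (i, j) (in_setT _) (in_setT _).
    rewrite /block_cov /block_col /= eqxx oi e eqxx !orbT oddD oi => /(_ isT) /=.
    by case: (g (i, j)) (g (i, j')) => u hu [v hv] /=; lia.
  have := h (i, j) (i, j') (in_setT _) (in_setT _).
  by rewrite /block_cov /block_col /= eqxx oi e eqxx oddD (negbTE oi) => /(_ isT).
have oi' : odd i' = ~~ odd i by rewrite e.
rewrite !ffunE /= oi'; case: (boolP (odd i)) => oi /=.
  have := h (i', ord_max) (i, ord_max) (in_setT _) (in_setT _).
  rewrite /block_cov /block_col /= oi' oi e !eqxx !orbT oddD oi => /(_ isT) /=.
  by case: (g (i, ord_max)) (g (i', ord_max)) => u hu [v hv] /=; lia.
have := h (i, ord_max) (i', ord_max) (in_setT _) (in_setT _).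
rewrite /block_cov /block_col /= oi' oi e !eqxx !orbT oddD /= (negbTE oi) => /(_ isT) /=.
by case: (g (i, ord_max)) (g (i', ord_max)) => u hu [v hv] /=; lia.
Qed.

Lemma card_block_maps n : #|block_maps n| =
  #|[set g : {ffun E -> 'I_n.+1} | order_ok block_col block_cov [set: E] (fun p => g p)]|.
Proof.
rewrite -(card_imset (block_maps n) (inv_inj (@flipK n))); apply: eq_card => g.
rewrite inE -flip_block_maps; apply/imsetP/idP => [[s sB ->]|h]; first by rewrite flipK.
by exists (flip g); rewrite ?flipK.
Qed.

(** * Lattice points as shifted prefix sums *)

Definition block_points q : {set {ffun E -> 'I_q.+1}} :=
  [set x : {ffun E -> 'I_q.+1} | [forall i : 'I_m, forall i' : 'I_m, (i' == i.+1 :> nat) ==>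
              (\sum_j x (i, j) + \sum_j x (i', j) <= q)%N]].

Lemma block_pointsP q (x : {ffun E -> 'I_q.+1}) :
  reflect (forall i i' : 'I_m, i' = i.+1 :> nat ->
              (\sum_j x (i, j) + \sum_j x (i', j) <= q)%N)
          (x \in block_points q).
Proof.
rewrite inE; apply: (iffP forallP) => h i.
  by move=> i' e; have /forallP/(_ i')/implyP := h i; apply; apply/eqP.
by apply/forallP => i'; apply/implyP => /eqP; apply: h.
Qed.

(** The origin of the bound [q + a]: the shifts at the ends of two adjacent rows and the strictness
    between them add up to [a]. *)
Lemma uphalf_double_max : (uphalf a' + uphalf a' + odd a = a)%N.
Proof. by rewrite /a /= uphalf_half; have := odd_double_half a'; lia. Qed.

Lemma block_maps_ge n (s : {ffun E -> 'I_n.+1}) i (j : 'I_a) :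
  s \in block_maps n -> (uphalf j <= s (i, j))%N.
Proof.
case/block_mapsP=> h _; case: j => j; elim: j => [|j IH] hj //=.
have := IH (ltnW hj); have := h i (Ordinal (ltnW hj)) (Ordinal hj) erefl.
rewrite /= uphalf_half; lia.
Qed.

Lemma card_block_maps_lt n : (n < a)%N -> #|block_maps n| = 0%N.
Proof.
move=> na; apply: eq_card0 => s; apply/negbTE/negP => sB.
have [_ /(_ (Ordinal (isT : (0 < m)%N)) (Ordinal (isT : (1 < m)%N)) erefl) h] := block_mapsP _ sB.
have max_ge i : (uphalf a' <= s (i, ord_max))%N by apply: (@block_maps_ge _ s i ord_max).
suff : (a <= n)%N by rewrite leqNgt na.
by rewrite -uphalf_double_max; apply: leq_trans h; rewrite leq_add2r leq_add ?max_ge.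
Qed.

Definition prefix q (x : {ffun E -> 'I_q.+1}) (i : 'I_m) k := (\sum_(j < a | (j < k)%N) x (i, j))%N.

Lemma prefix0 q (x : {ffun E -> 'I_q.+1}) i : prefix x i 0 = 0%N.
Proof. by rewrite /prefix big_pred0. Qed.

Lemma prefixS q (x : {ffun E -> 'I_q.+1}) i (j : 'I_a) :
  prefix x i j.+1 = (prefix x i j + x (i, j))%N.
Proof.
rewrite /prefix (bigD1 j) //= addnC; congr (_ + _)%N; apply: eq_bigl => k.
by rewrite -val_eqE /=; lia.
Qed.

Lemma prefix_all q (x : {ffun E -> 'I_q.+1}) i : prefix x i a = (\sum_j x (i, j))%N.
Proof. by apply: eq_bigl => j; rewrite ltn_ord. Qed.

Lemma prefix_le q (x : {ffun E -> 'I_q.+1}) i k : (prefix x i k <= \sum_j x (i, j))%N.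
Proof. by rewrite /prefix [leqRHS](bigID (fun j : 'I_a => (j < k)%N)) leq_addr. Qed.

Lemma block_points_row q (x : {ffun E -> 'I_q.+1}) i : x \in block_points q ->
  (\sum_j x (i, j) <= q)%N.
Proof.
move/block_pointsP => h; have [i' /orP[]/eqP e] := block_neighbour i.
  exact: leq_trans (leq_addr _ _) (h _ _ e).
exact: leq_trans (leq_addl _ _) (h _ _ e).
Qed.

(* [uphalf j] is the shift making the relations of a chain alternately strict and weak. *)
Definition cumulate q (x : {ffun E -> 'I_q.+1}) : {ffun E -> 'I_(q + a).+1} :=
  [ffun p : E => inord (prefix x p.1 p.2.+1 + uphalf p.2)].

Lemma cumulateE q (x : {ffun E -> 'I_q.+1}) p : x \in block_points q ->
  cumulate x p = (prefix x p.1 p.2.+1 + uphalf p.2)%N :> nat.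
Proof.
move=> /block_points_row h; rewrite ffunE inordK // ltnS leq_add //.
  exact: leq_trans (prefix_le _ _ _) (h _).
by apply: leq_trans (ltnW (ltn_ord p.2)); rewrite leq_uphalf_double -addnn leq_addr.
Qed.

Lemma cumulate_in q (x : {ffun E -> 'I_q.+1}) : x \in block_points q ->
  cumulate x \in block_maps (q + a).
Proof.
move=> xX; apply/block_mapsP; split=> [i j j' e|i i' e]; rewrite !cumulateE //=.
  rewrite (prefixS x i j') e /= uphalf_half.
  by move: (prefix x i j.+1) (x (i, j')) => u [v hv] /=; lia.
rewrite !prefix_all addnACA -addnA uphalf_double_max leq_add2r.
by have /block_pointsP/(_ _ _ e) := xX.
Qed.

Lemma cumulate_inj q : {in @block_points q &, injective (@cumulate q)}.
Proof.
move=> x y xX yX e; apply/ffunP => -[i j].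
have P (k : 'I_a) : prefix x i k.+1 = prefix y i k.+1.
  by apply/eqP; rewrite -(eqn_add2r (uphalf k)) -(cumulateE (i, k) xX) e cumulateE.
have P' : prefix x i j = prefix y i j.
  case: j => -[|j] hj /=; first by rewrite !prefix0.
  exact: P (Ordinal (ltnW hj)).
by apply/val_inj/eqP; rewrite -(eqn_add2l (prefix x i j)) -prefixS P P' prefixS.
Qed.

Lemma cumulate_onto q (s : {ffun E -> 'I_(q + a).+1}) : s \in block_maps (q + a) ->
  exists2 x, x \in block_points q & s = cumulate x.
Proof.
move=> sB; have [h1 h2] := block_mapsP _ sB.
(* The prefix sums recovered from [s] by undoing the shift; the truncated subtraction is exact by
   [block_maps_ge]. *)
pose u (i : 'I_m) (k : nat) := if k is l.+1 then (s (i, inord l) - uphalf l)%N else 0%N.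
have uS i (j : 'I_a) : (u i j <= u i j.+1)%N.
  case: j => -[|j] hj //=; have := h1 i (inord j) (inord j.+1).
  rewrite !inordK ?(ltnW hj) // => /(_ erefl) /=; rewrite uphalf_half.
  by move: (s (i, inord j)) (s (i, inord j.+1)) => [v hv] [w hw] /=; lia.
have u_le i (k l : nat) : (k <= l)%N -> (l <= a)%N -> (u i k <= u i l)%N.
  elim: l => [|l IH]; first by rewrite leqn0 => /eqP ->.
  rewrite leq_eqVlt => /predU1P[->//|kl] la.
  exact: leq_trans (IH kl (ltnW la)) (uS i (Ordinal la)).
have ua (i i' : 'I_m) : i' = i.+1 :> nat -> (u i a + u i' a <= q)%N.
  move=> e; have := h2 _ _ e; have := uphalf_double_max; rewrite /u /a.
  have o : inord a' = ord_max :> 'I_a by apply: val_inj; rewrite /= inordK.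
  rewrite o; have := block_maps_ge i ord_max sB; have := block_maps_ge i' ord_max sB.
  move: (s (i, ord_max)) (s (i', ord_max)) => [v hv] [w hw] /=; rewrite /a; lia.
have uq i k : (k <= a)%N -> (u i k <= q)%N.
  move=> ka; apply: leq_trans (u_le _ _ _ ka (leqnn _)) _.
  have [i' /orP[]/eqP e] := block_neighbour i.
    exact: leq_trans (leq_addr _ _) (ua _ _ e).
  exact: leq_trans (leq_addl _ _) (ua _ _ e).
pose x : {ffun E -> 'I_q.+1} := [ffun p : E => inord (u p.1 p.2.+1 - u p.1 p.2)].
have xE i j : x (i, j) = (u i j.+1 - u i j)%N :> nat.
  by rewrite ffunE inordK // ltnS (leq_trans (leq_subr _ _)) // uq.
have pE i k : (k <= a)%N -> prefix x i k = u i k.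
  elim: k => [|k IH] ka; first by rewrite prefix0.
  by rewrite (prefixS x i (Ordinal ka)) IH ?(ltnW ka) // xE /= subnKC // (uS i (Ordinal ka)).
have xX : x \in block_points q.
  by apply/block_pointsP => i i' e; rewrite -!prefix_all !pE // ua.
exists x => //; apply/ffunP => -[i j]; apply: val_inj.
rewrite /= cumulateE // pE //= inord_val subnK //.
exact: block_maps_ge.
Qed.

Lemma card_block_points q : #|block_points q| = #|block_maps (q + a)|.
Proof.
rewrite -(card_in_imset (@cumulate_inj q)); apply: eq_card => s.
apply/imsetP/idP => [[x xX ->]|/cumulate_onto[x xX ->]]; last by exists x.
exact: cumulate_in.
Qed.

Lemma card_block_points0 : #|block_points 0| = 1%N.
Proof.
have -> : block_points 0 = [set [ffun=> ord0]].
  apply/setP => x; rewrite in_set1; have -> : x = [ffun=> ord0].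
    by apply/ffunP => p; rewrite ffunE; apply: ord1.
  rewrite eqxx; apply/block_pointsP => i i' _.
  by rewrite !big1 // => j _; rewrite ffunE.
by rewrite cards1.
Qed.

(** No map has bound [n < a], and the only one with bound [a] comes from the origin; hence the
    lowest term of [W] is [z^a]. *)
Lemma block_points_gf : exists W,
  [/\ has_gf (fun n => if (n < a)%N then 0 else #|block_points (n - a)|%:R) W (m * a).+1,
      gamma_pos (m * a) W, forall k, (k < a)%N -> W`_k = 0 & W`_a = 1].
Proof.
have [f [W]] := order_map_gf block_col_cov block_cov_below block_cov_above.
rewrite card_prod !card_ord => -[h1 h2 h3]; exists W.
have fE n : f n = if (n < a)%N then 0 else #|block_points (n - a)|%:R.
  rewrite -h1 -card_block_maps; case: ltnP => na; first by rewrite card_block_maps_lt.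
  by rewrite card_block_points subnK.
have WE k : (k <= a)%N -> W`_k = if (k < a)%N then 0 else 1.
  move=> ka; rewrite -(h2 k.+1 k) // coefM big_ord_recr /= subnn big1 ?add0r => [|i _].
    rewrite coef_trunc_series // fE; case: ltnP => ka'; first by rewrite mul0r.
    have -> : k = a by apply/eqP; rewrite eqn_leq ka.
    rewrite subnn card_block_points0 mul1r -horner_coef0.
    by rewrite horner_exp hornerD hornerN hornerC hornerX subr0 expr1n.
  rewrite coef_trunc_series ?fE; last by apply: ltnW; rewrite ltnS.
  by rewrite (leq_trans (ltn_ord i) ka) mul0r.
split=> //; first exact: has_gf_ext h2.
  by move=> k ka; rewrite WE ?ka // ltnW.
by rewrite WE // ltnn.
Qed.

End PathBlocks.

(** * Symmetric numerators *)

Lemma has_gf_unshift (c : nat -> rat) (W h : {poly rat}) s d :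
  has_gf (fun n => if (n < s)%N then 0 else c (n - s)%N) W d ->
  (forall k, h`_k = W`_(k + s)) -> has_gf c h d.
Proof.
move=> gfW hW N k kN; rewrite hW -(gfW (k + s).+1 (k + s)%N) // !coefM.
have e : ((k + s).+1 = s + k.+1)%N by lia.
rewrite e big_split_ord /= [in RHS]big1 ?add0r => [|i _]; last first.
  rewrite coef_trunc_series ?ltn_ord ?mul0r //.
  by move: (ltn_ord i); lia.
apply: eq_bigr => i _; have ik := ltn_ord i.
rewrite !coef_trunc_series; [| lia..].
rewrite ltnNge leq_addr /= addKn; congr (_ * _`__); lia.
Qed.

Lemma has_gf_series_eq_quotient f h d :
  has_gf f h d -> series_eq_quotient f h ((1 - 'X) ^+ d).
Proof.
move=> gfh k; rewrite -(gfh k.+1) // mulrC coefM; apply: eq_bigr => i _.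
by rewrite coef_trunc_series // ltnS leq_subr.
Qed.

(** The binomial coefficient [C(X - j + D, D)] as a polynomial in [X]; it gives the coefficients of
    [z^j / (1 - z)^(D + 1)]. *)
Definition bin_poly D j : {poly rat} :=
  (D`!%:R)^-1 *: \prod_(i < D) ('X + (i.+1%:R - j%:R)%:P).

(** For [q < j] the polynomial vanishes, because [j <= D] makes [X - q] one of its factors. This is
    why the counts are polynomial from [q = 0] on. *)
Lemma bin_polyE D j q : (j <= D)%N ->
  (bin_poly D j).[q%:R] = if (j <= q)%N then ('C(q - j + D, D))%:R else 0.
Proof.
move=> jD; rewrite hornerZ horner_prod.
under eq_bigr => i _ do rewrite hornerD hornerX hornerC.
case: leqP => jq.
  have -> : \prod_(i < D) (q%:R + (i.+1%:R - j%:R)) = ((q - j + D) ^_ D)%:R :> rat.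
    rewrite ffact_prod natr_prod (reindex_inj rev_ord_inj) /=.
    apply: eq_bigr => i _; have iD := ltn_ord i; rewrite subnSK //.
    have -> : (q - j + D - i = q + (D - i) - j)%N by lia.
    by rewrite [in RHS]natrB ?natrD; [ring | lia].
  rewrite -bin_ffact natrM mulrC mulfK // pnatr_eq0 -lt0n.
  exact: fact_gt0.
have h : (j - q.+1 < D)%N by lia.
rewrite (bigD1 (Ordinal h)) //=.
have -> : q%:R + ((j - q.+1).+1%:R - j%:R) = 0 :> rat.
  have -> : (j - q.+1).+1 = (j - q)%N by lia.
  by rewrite natrB ?(ltnW jq) //; ring.
by rewrite mul0r mulr0.
Qed.

(** Both sides are [(-1)^D C(X + j - 1, D)]: the relation between [j], [l] and [s] gives
    [X - s - l + D = X + j - 1]. *)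
Lemma bin_poly_reflect D j l s : (j + l + s = D.+1)%N ->
  bin_poly D j \Po (- 'X) = (-1) ^+ D *: (bin_poly D l \Po ('X - s%:R%:P)).
Proof.
move=> jls; rewrite !comp_polyZ scalerA mulrC -scalerA; congr (_ *: _).
rewrite !rmorph_prod /= -[(-1) ^+ D](_ : \prod_(i < D) (-1) = _); last first.
  by rewrite prodr_const card_ord.
rewrite -mul_polyC rmorph_prod -big_split /= (reindex_inj rev_ord_inj) /=.
apply: eq_bigr => i _; have iD := ltn_ord i; rewrite subnSK //.
rewrite !comp_polyD !comp_polyX !comp_polyC.
have -> : (D - i)%N%:R = j%:R + l%:R + s%:R - i.+1%:R :> rat.
  have -> : (D - i = j + l + s - i.+1)%N by lia.
  by rewrite natrB ?natrD; [ | lia].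
by rewrite !polyCD !polyCN; ring.
Qed.

Lemma expr_subn (F : fieldType) (x : F) n i : x != 0 -> (i <= n)%N ->
  x ^+ (n - i) = x ^+ n * x^-1 ^+ i.
Proof. by move=> x0 ni; rewrite exprVn -expfB_cond // (negbTE x0). Qed.

Section SymmetricQuotient.
Variables (c : nat -> rat) (W : {poly rat}) (N s : nat).
Let D := (N + s.*2)%N.
Hypothesis gfW : has_gf (fun n => if (n < s)%N then 0 else c (n - s)%N) W D.+1.
Hypothesis gammaW : gamma_pos D W.
Hypothesis W_low : forall k, (k < s)%N -> W`_k = 0.
Hypothesis W_s : W`_s = 1.

Let h : {poly rat} := \poly_(k < N.+1) W`_(k + s).

(** By symmetry the coefficients of [W] above [N + s] vanish with those below [s], so the truncation
    loses nothing and [h = W / z^s]. In use, [s = a], [N = a (m - 2)] and [D = a m]. *)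
Lemma quotient_coef k : h`_k = W`_(k + s).
Proof.
rewrite coef_poly ltnS; case: leqP => // Nk; apply/esym.
have [kD|kD] := leqP (k + s) D; last exact: gamma_pos_gt kD.
by rewrite (gamma_pos_sym gammaW kD) W_low //; rewrite /D; lia.
Qed.

Lemma quotient_gf : has_gf c h D.+1.
Proof. exact: has_gf_unshift gfW quotient_coef. Qed.

Lemma quotient_sym k : (k <= N)%N -> h`_k = h`_(N - k).
Proof.
move=> kN; rewrite !quotient_coef (gamma_pos_sym gammaW); last by rewrite /D; lia.
by congr (_`__); rewrite /D; lia.
Qed.

Lemma quotient_size : size h = N.+1.
Proof.
by apply: size_poly_eq; rewrite -quotient_coef quotient_sym // subnn quotient_coef W_s oner_eq0.
Qed.

Lemma quotient_unimodal : unimodal h.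
Proof.
have mono i j : (i <= j)%N -> (j <= N./2)%N -> h`_i <= h`_j.
  elim: j => [|j IH]; first by rewrite leqn0 => /eqP ->.
  rewrite leq_eqVlt => /predU1P[->//|ij] jN.
  apply: le_trans (IH ij (ltnW jN)) _; rewrite !quotient_coef.
  by apply: (gamma_pos_mono gammaW); rewrite /D; lia.
exists N./2; rewrite quotient_size; split; first by lia.
  by move=> i j /andP[]; apply: mono.
move=> i j /andP[Ni ij] jN.
have [->|ne] := eqVneq i j; first by [].
have [iN|iN] := leqP (N - i) N./2.
  by rewrite (@quotient_sym j) // (@quotient_sym i); [apply: mono; lia | lia].
(* Here [N] is odd and [i = N./2] is the first of the two middle indices. *)
by rewrite (@quotient_sym j) //; apply: mono; move: ne; lia.
Qed.

Lemma quotient_palindromic :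
  rational_function h = rational_function 'X ^+ N * eval_at_inverse h.
Proof.
have X0 : rational_function 'X != 0 by rewrite /rational_function tofrac_eq0 polyX_eq0.
rewrite /eval_at_inverse.
have -> : map_poly (fun c => rational_function c%:P) h =
    \poly_(k < N.+1) rational_function (h`_k)%:P.
  apply/polyP => k; rewrite coef_map_id0; last exact: rmorph0.
  rewrite [RHS]coef_poly; case: ltnP => // kN.
  by rewrite nth_default ?quotient_size // /rational_function polyC0 tofrac0.
rewrite horner_poly -[in LHS](coefK h) quotient_size poly_def.
rewrite /rational_function rmorph_sum mulr_sumr /= (reindex_inj rev_ord_inj) /=.
apply: eq_bigr => i _; rewrite subSS.
have iN : (i <= N)%N by rewrite -ltnS.
rewrite -quotient_sym // -mul_polyC rmorphM rmorphXn /= mulrCA; congr (_ * _).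
exact: expr_subn.
Qed.

(** Expand the counts in the polynomials [bin_poly D j] and exchange [j] with [N - j]. The symmetry
    of [h] pairs the coefficients, and the reflection applies with shift [D + 1 - N = 2 s + 1],
    which becomes [2 a + 1]. *)
Lemma quotient_polynomial : exists L : {poly rat},
  (forall q, L.[q%:R] = c q) /\
  L \Po (- 'X) = (-1) ^+ D *: (L \Po ('X - (s.*2.+1)%:R%:P)).
Proof.
exists (\sum_(j < N.+1) h`_j *: bin_poly D j); split=> [q|].
  rewrite (has_gf_coef q quotient_gf) horner_sum.
  pose F j := h`_j * (if (j <= q)%N then ('C(q - j + D, D))%:R else 0).
  transitivity (\sum_(j < N.+1) F j).
    apply: eq_bigr => j _; have jN := ltn_ord j.
    by rewrite hornerZ bin_polyE //; move: jN; rewrite /D; lia.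
  transitivity (\sum_(j < q.+1) F j); last first.
    by apply: eq_bigr => j _; rewrite /F -ltnS ltn_ord.
  have [Nq|qN] := leqP N q.
    rewrite (big_ord_widen q.+1 F) // big_mkcond; apply: eq_bigr => j _ /=.
    by case: ltnP => // Nj; rewrite /F nth_default ?mul0r // quotient_size.
  rewrite [RHS](big_ord_widen N.+1 F (leqW qN)) [RHS]big_mkcond; apply: eq_bigr => j _ /=.
  by case: ltnP => // Nj; rewrite /F leqNgt Nj mulr0.
rewrite !raddf_sum /= (reindex_inj rev_ord_inj) /=.
apply: eq_bigr => j _; rewrite subSS; have jN : (j <= N)%N by rewrite -ltnS.
have jls : (N - j + j + s.*2.+1 = D.+1)%N by rewrite /D; lia.
rewrite -quotient_sym // [LHS]comp_polyZ (bin_poly_reflect jls).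
by rewrite [X in _ = _ *: X]comp_polyZ !scalerA mulrC.
Qed.

End SymmetricQuotient.

(** * The block graph *)

Section BlockGraph.
Variables (m n : nat).
Let V : finType := ('I_m * 'I_n)%type.
Implicit Types (U K : {set V}) (p : V).

(** An interval graph, with [[i, i + 1]] for the vertices of block [i]. Two consecutive blocks form
    a clique, whose inequality is [R_i + R_{i+1} <= 1]. *)
Definition block_adj : rel ('I_m * 'I_n) :=
  fun p p' => [&& p != p', (p.1 <= p'.1.+1)%N & (p'.1 <= p.1.+1)%N].

Lemma block_adj_sym : symmetric block_adj.
Proof. by move=> p p'; rewrite /block_adj eq_sym [X in _ && X]andbC. Qed.

Lemma block_adj_simple : simple_graph block_adj.
Proof. by split; [exact: block_adj_sym | move=> p; rewrite /block_adj eqxx]. Qed.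

Lemma block_adj_chordal : chordal block_adj.
Proof.
move=> c uc cc sc.
have [x0 x0c] : exists x, x \in c by case: c sc {uc cc} => // x c _; exists x; rewrite mem_head.
(* The two cycle neighbours of a vertex in the first block met by the cycle are adjacent. *)
case: (@arg_minnP _ x0 (fun x => x \in c) (fun x : V => x.1) x0c) => x xc xmin.
case: (rot_to xc) => i c' rc.
have uc' : uniq (x :: c') by rewrite -rc rot_uniq.
have cc' : cycle block_adj (x :: c') by rewrite -rc rot_cycle.
have sc' : (3 <= size c')%N by move: sc; rewrite -(size_rot i) rc.
have mc' y : (y \in x :: c') = (y \in c) by rewrite -rc mem_rot.
have nc y : next c y = next (x :: c') y by rewrite -rc next_rot.
case: c' rc uc' cc' sc' mc' nc => [|y [|z s]] // rc uc' cc' sc' mc' nc.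
case: (lastP s) rc uc' cc' sc' mc' nc => [|s' w] // rc uc' cc' sc' mc' nc.
have yx : next (x :: y :: z :: rcons s' w) x = y by rewrite /= eqxx.
have xy : x != y by move: uc'; rewrite /= inE negb_or => /andP[/andP[]].
have yz : next (x :: y :: z :: rcons s' w) y = z by rewrite /= eq_sym (negbTE xy) eqxx.
have wc : w \in c by rewrite -mc' !inE mem_rcons mem_head !orbT.
have yc : y \in c by rewrite -mc' !inE eqxx orbT.
have wyz : (w != y) && (w != z).
  move: uc'; rewrite /= !inE !mem_rcons !inE !negb_or.
  by case/and4P=> _ /and3P[_ yw _] /andP[zw _] _; rewrite !(eq_sym w) yw zw.
have xw : x != w.
  by move: uc'; rewrite /= !inE !mem_rcons !inE !negb_or => /andP[/and4P[]].
have exy : block_adj x y by move: cc' => /= /andP[].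
have ewx : block_adj w x.
  by move: cc'; rewrite /= !rcons_path last_rcons => /and4P[_ _ _].
have [wy wz] := andP wyz.
exists y, w; split=> //; rewrite ?nc.
- move: exy ewx => /and3P[_ h1 h2] /and3P[_ h3 h4].
  have h5 := xmin _ wc; have h6 := xmin _ yc.
  rewrite /block_adj eq_sym wy /=; apply/andP; split.
    exact: leq_trans h2 _.
  exact: leq_trans h3 _.
- by rewrite yz.
(* [next] is injective on the cycle and sends [x] to [y], so it sends [w] to [y] only if [w = x]. *)
apply: contraNneq xw => e; rewrite -[x](prev_next uc') yx.
by apply/eqP; rewrite -[RHS](prev_next uc') -e.
Qed.

Definition block_part (U : {set V}) (i : 'I_m) := [set p in U | p.1 == i].

Definition block_rank (U : {set V}) (p : V) :=
  #|[set p' in U | (p'.1 == p.1) && (p'.2 < p.2)%N]|.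

Lemma block_rank_lt U p : p \in U -> (block_rank U p < #|block_part U p.1|)%N.
Proof.
move=> pU; apply/proper_card/properP; split.
  by apply/subsetP => p'; rewrite !inE => /and3P[-> ->].
by exists p; rewrite !inE pU eqxx //= ltnn.
Qed.

Lemma block_rank_mono U p p' : p \in U -> p.1 = p'.1 -> (p.2 < p'.2)%N ->
  (block_rank U p < block_rank U p')%N.
Proof.
move=> pU e lt; apply/proper_card/properP; split.
  apply/subsetP => r; rewrite !inE e => /and3P[-> -> /=].
  by move/ltn_trans; apply.
by exists p; rewrite !inE pU e ?eqxx ?lt //= ltnn.
Qed.

Lemma clique_number_ge (U K : {set V}) :
  K \subset U -> clique block_adj K -> (#|K| <= clique_number block_adj U)%N.
Proof. by move=> KU cK; apply: (leq_bigmax_cond (F := fun K : {set V} => #|K|)); rewrite KU. Qed.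

Lemma block_part_clique (U : {set V}) (i i' : 'I_m) : (i <= i'.+1)%N -> (i' <= i.+1)%N ->
  (#|block_part U i :|: block_part U i'| <= clique_number block_adj U)%N.
Proof.
move=> h h'; apply: clique_number_ge.
  by apply/subsetP => p; rewrite !inE => /orP[] /andP[].
apply/forall_inP => p; rewrite !inE => pK; apply/forall_inP => p'; rewrite !inE => pK'.
apply/implyP => ne; rewrite /block_adj ne /=.
by move: pK pK' => /orP[]/andP[_ /eqP ->] /orP[]/andP[_ /eqP ->]; rewrite ?h ?h' ?leqnSn.
Qed.

Lemma block_part_clique2 (U : {set V}) (i i' : 'I_m) :
  i != i' -> (i <= i'.+1)%N -> (i' <= i.+1)%N ->
  (#|block_part U i| + #|block_part U i'| <= clique_number block_adj U)%N.
Proof.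
move=> ne h h'; have := block_part_clique U h h'; rewrite cardsU.
have -> : block_part U i :&: block_part U i' = set0.
  apply/setP => p; rewrite !inE; apply/negbTE/negP => /andP[/andP[_ /eqP e] /andP[_ /eqP e']].
  by move: ne; rewrite -e e' eqxx.
by rewrite cards0 subn0.
Qed.

Lemma block_part_clique1 (U : {set V}) (i : 'I_m) :
  (#|block_part U i| <= clique_number block_adj U)%N.
Proof. by have := block_part_clique U (leqnSn i) (leqnSn i); rewrite setUid. Qed.

(** The lower bound is the injectivity of a colouring on a clique. For the upper bound, two
    consecutive blocks have together at most [w] vertices in [U], so colours assigned from opposite
    ends do not meet. *)
Lemma block_adj_perfect : perfect block_adj.
Proof.
move=> U; set w := clique_number block_adj U; split; last first.
  move=> l [f [fl fe]]; apply/bigmax_leqP => K /andP[/subsetP KU cK].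
  rewrite cardE -(size_map f) -[leqRHS](size_iota 0 l); apply: uniq_leq_size.
    rewrite map_inj_in_uniq ?enum_uniq // => p p'; rewrite !mem_enum => pK pK' e.
    apply/eqP/negPn/negP => ne; have /forall_inP/(_ _ pK')/implyP/(_ ne) := forall_inP cK _ pK.
    by move/(fe _ _ (KU _ pK) (KU _ pK')); rewrite e eqxx.
  by move=> y /mapP[p]; rewrite mem_enum => /KU/fl pl ->; rewrite mem_iota.
(* Even blocks use the first colours and odd blocks the last ones. *)
exists (fun p => if odd p.1 then (w - (block_rank U p).+1)%N else block_rank U p); split.
  move=> p pU; have := block_rank_lt pU; have := block_part_clique1 U p.1; rewrite -/w.
  by case: ifP => _; lia.
suff H (p p' : V) : p \in U -> p' \in U -> block_adj p p' -> (p.1 < p'.1)%N || (p.1 == p'.1) && (p.2 < p'.2)%N ->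
   (if odd p.1 then (w - (block_rank U p).+1)%N else block_rank U p) !=
   (if odd p'.1 then (w - (block_rank U p').+1)%N else block_rank U p').
  move=> p p' pU p'U e; case: (ltngtP p.1 p'.1) => h.
  - by apply: H; rewrite ?h.
  - by rewrite eq_sym; apply: H; rewrite ?h // block_adj_sym.
  have h' : p.1 = p'.1 by apply: val_inj.
  case: (ltngtP p.2 p'.2) => h2.
  - by apply: H => //; rewrite h' eqxx h2 orbT.
  - by rewrite eq_sym; apply: H; rewrite 1?block_adj_sym // h' eqxx h2 orbT.
  move: e; have -> : p = p'; last by rewrite /block_adj eqxx.
  by case: p p' h' h2 {pU p'U h} => i j [i' j'] /= -> /val_inj ->.
move=> pU p'U /and3P[_ h1 h2] /orP[lt|/andP[/eqP e lt]].
  have ne : p.1 != p'.1 by rewrite -val_eqE neq_ltn lt.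
  have e : p'.1 = p.1.+1 :> nat by apply/eqP; rewrite eqn_leq h2 lt.
  have := block_part_clique2 U ne h1 h2; rewrite -/w e /=.
  have := block_rank_lt pU; have := block_rank_lt p'U.
  by case: (odd p.1) => /=; lia.
have := block_rank_mono pU e lt; have := block_rank_lt p'U.
have := block_part_clique1 U p'.1; rewrite -/w e.
by case: ifP => _; lia.
Qed.

End BlockGraph.

(** * Lengths of intervals as finite weighted sums *)

(** A Riemann sum of the indicator of [t >= c], exact because [c] is one of the breakpoints: the
    gaps beyond it telescope. *)
Lemma step_sum (R : realFieldType) (x : R) s c : path <=%R x s -> c \in x :: s ->
  \sum_(k < size s) ((x :: s)`_k.+1 - (x :: s)`_k) * (c <= (x :: s)`_k)%R%:R = last x s - c.
Proof.
elim: s x c => [|y s IH] x c /= ps cs.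
  by move: cs; rewrite inE => /eqP ->; rewrite big_ord0 subrr.
have /andP[xy py] := ps; rewrite big_ord_recl /=.
have sorted_ge k : (k < size (y :: s))%N -> y <= (y :: s)`_k.
  move=> hk; have /allP := order_path_min (@le_trans _ R) py.
  by case: k hk => [|k] hk h; [exact: lexx | apply: h; apply: mem_nth].
move: cs; rewrite inE => /predU1P[->|cs].
  rewrite lexx mulr1.
  have -> : \sum_(k < size s) ((y :: s)`_k.+1 - (y :: s)`_k) * (x <= (y :: s)`_k)%R%:R =
            \sum_(k < size s) ((y :: s)`_k.+1 - (y :: s)`_k) * (y <= (y :: s)`_k)%R%:R.
    apply: eq_bigr => k _; have hk : (k < size (y :: s))%N by rewrite ltnW // ltnS ltn_ord.
    by rewrite sorted_ge // (le_trans xy) // sorted_ge.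
  by rewrite IH ?mem_head //; ring.
rewrite [X in _ + X](_ : _ = last y s - c); last exact: IH.
have yc : y <= c.
  move: cs => /(nthP 0)[k hk <-]; exact: sorted_ge.
case: (leP c x) => cx; last by rewrite mulr0 add0r.
have -> : y = x by apply/eqP; rewrite eq_le xy (le_trans yc cx).
by rewrite subrr mul0r add0r.
Qed.

(** A finite substitute for the uniform measure on [[0, 1]], which measures exactly every interval
    with end points in [L]. The breakpoints are 0, the sorted [L] and 1. *)
Lemma step_weights (R : realFieldType) (L : seq R) : all (fun c => 0 <= c <= 1) L ->
  exists (N : nat) (t w : 'I_N -> R),
    [/\ forall k, 0 <= w k, \sum_k w k = 1 &
        forall c, c \in L -> \sum_k w k * (c <= t k)%R%:R = 1 - c].
Proof.
move=> /allP hL; pose s := rcons (sort <=%R L) 1.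
have pL : path <=%R 0 (sort <=%R L).
  rewrite path_min_sorted ?(sort_sorted (@le_total _ R)) //.
  by apply/allP => c; rewrite mem_sort => /hL/andP[].
have ps : path <=%R 0 s.
  rewrite rcons_path pL /=; case/lastP: (sort _ L) (mem_sort <=%R L) => [|l c] ml.
    by rewrite /= ler01.
  by rewrite last_rcons; have /hL/andP[] : c \in L by rewrite -ml mem_rcons mem_head.
have s_ge0 k : (k < size s)%N -> 0 <= (0 :: s)`_k.
  case: k => [|k] // hk; have /allP := order_path_min (@le_trans _ R) ps.
  by apply; apply: mem_nth; apply: ltnW.
exists (size s), (fun k => (0 :: s)`_k), (fun k => (0 :: s)`_k.+1 - (0 :: s)`_k).
have S c : c \in 0 :: s -> \sum_(k < size s) ((0 :: s)`_k.+1 - (0 :: s)`_k) *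
    (c <= (0 :: s)`_k)%R%:R = 1 - c.
  by move=> cs; rewrite step_sum // last_rcons.
split.
- by move=> k; rewrite subr_ge0; have /(pathP 0)/(_ k (ltn_ord k)) := ps.
- rewrite -[RHS]subr0 -(S 0) ?mem_head //; apply: eq_bigr => k _.
  by rewrite s_ge0 // mulr1.
by move=> c cL; apply: S; rewrite inE mem_rcons inE mem_sort cL !orbT.
Qed.

(** * Stable sets *)

Section StableSets.
Variables (R : realType) (m' n : nat).
Let m := m'.+2.
Implicit Types (x : 'M[R]_(m, n)) (S : {set 'I_m * 'I_n}).

Definition row_total x i := \sum_j x i j.

Lemma stable_two_blocks S (i i' : 'I_m) : stable (@block_adj m n) S ->
  i' = i.+1 :> nat ->
  (\sum_j ((i, j) \in S) + \sum_j ((i', j) \in S) <= 1)%N.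
Proof.
move=> sS e; pose T := [set p in S | (p.1 == i) || (p.1 == i')].
have T1 : (#|T| <= 1)%N.
  apply/card_le1_eqP => p q; rewrite !inE => /andP[pS hp] /andP[qS hq].
  apply/eqP/negPn/negP => ne; have /forall_inP/(_ _ qS)/negP := forall_inP sS _ pS; apply.
  rewrite /block_adj eq_sym ne /=.
  by move: hp hq => /orP[]/eqP-> /orP[]/eqP->; rewrite ?e !(leqnn, leqnSn, leqW).
have TE : #|T| = (\sum_k \sum_j if (k, j) \in T then 1 else 0)%N.
  by rewrite pair_bigA /= -sum1_card big_mkcond; apply: eq_bigr => -[].
apply: leq_trans T1; rewrite TE.
have ne : i' != i by rewrite -val_eqE /= e gtn_eqF.
rewrite (bigD1 i) //= (bigD1 i') //= addnA; apply: leq_trans (leq_addr _ _).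
apply: leq_add; apply: leq_sum => j _; rewrite inE /= eqxx ?orbT andbT.
  by case: ((i, j) \in S).
by case: ((i', j) \in S).
Qed.

Lemma STAB_sub x : STAB R (@block_adj m n) x -> path_block_polytope R n m x.
Proof.
move=> [N [p [w [pS w0 w1 ->]]]]; split=> [i j|i i' e].
  rewrite summxE sumr_ge0 // => k _; rewrite mxE mulr_ge0 //.
  by have [S [_ ->]] := pS k; rewrite mxE.
have E k : \sum_j (\sum_l w l *: p l) k j = \sum_l w l * \sum_j p l k j.
  rewrite (eq_bigr (fun j => \sum_l w l * p l k j)) => [|j _].
    by rewrite exchange_big /=; apply: eq_bigr => l _; rewrite mulr_sumr.
  by rewrite summxE; apply: eq_bigr => l _; rewrite mxE.
rewrite !E -big_split /= -w1; apply: ler_sum => l _; rewrite -mulrDr.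
rewrite -[leRHS]mulr1; apply: ler_wpM2l => //.
have [S [sS ->]] := pS l; have := stable_two_blocks sS e.
rewrite -(ler_nat R) natrD !natr_sum; apply: le_trans.
by rewrite le_eqVlt; apply/orP; left; apply/eqP; congr (_ + _); apply: eq_bigr => j _; rewrite mxE.
Qed.

Definition row_prefix x i k := \sum_(j < n | (j < k)%N) x i j.

Lemma row_prefixS x i (j : 'I_n) : row_prefix x i j.+1 = row_prefix x i j + x i j.
Proof.
rewrite /row_prefix (bigD1 j) //= addrC; congr (_ + _); apply: eq_bigl => k.
by rewrite -val_eqE /=; lia.
Qed.

Lemma row_prefix_le x i k l : (forall j, 0 <= x i j) -> (k <= l)%N ->
  row_prefix x i k <= row_prefix x i l.
Proof.
move=> x0 kl; rewrite /row_prefix [leRHS](bigID (fun j : 'I_n => (j < k)%N)) /=.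
rewrite (eq_bigl (fun j : 'I_n => (j < l)%N && (j < k)%N)) => [|j]; last first.
  by case: (ltnP j k) => jk; rewrite ?andbF // (leq_trans jk kl).
by rewrite lerDl sumr_ge0.
Qed.

Lemma row_prefix_ge0 x i k : (forall j, 0 <= x i j) -> 0 <= row_prefix x i k.
Proof. by move=> x0; apply: sumr_ge0. Qed.

Lemma row_prefix_total x i k : (forall j, 0 <= x i j) -> row_prefix x i k <= row_total x i.
Proof.
by move=> x0; rewrite /row_total [leRHS](bigID (fun j : 'I_n => (j < k)%N)) lerDl sumr_ge0.
Qed.

Definition slot_lo x (p : 'I_m * 'I_n) :=
  if odd p.1 then 1 - row_prefix x p.1 p.2.+1 else row_prefix x p.1 p.2.

Definition slot_hi x (p : 'I_m * 'I_n) :=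
  if odd p.1 then 1 - row_prefix x p.1 p.2 else row_prefix x p.1 p.2.+1.

(** Slots are half-open, so that neighbouring slots of one block do not share their common end
    point. *)
Definition slot_set x t : {set 'I_m * 'I_n} := [set p | slot_lo x p <= t < slot_hi x p].

Lemma slot_hiB x p : slot_hi x p - slot_lo x p = x p.1 p.2.
Proof. by rewrite /slot_hi /slot_lo row_prefixS; case: ifP => _; ring. Qed.

Lemma block_row_total_le1 x i : path_block_polytope R n m x -> row_total x i <= 1.
Proof.
move=> [x0 h]; have t0 k : 0 <= row_total x k by apply: sumr_ge0.
have [i' /orP[]/eqP e] := block_neighbour i; apply: le_trans (h _ _ e).
  by rewrite /row_total lerDl t0.
by rewrite /row_total lerDr t0.
Qed.

Lemma slot_bounds x p : path_block_polytope R n m x ->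
  0 <= slot_lo x p /\ slot_hi x p <= 1.
Proof.
move=> xP; have [x0 _] := xP; have r1 := block_row_total_le1 p.1 xP.
have h k := row_prefix_total k (x0 p.1); have h0 k := row_prefix_ge0 k (x0 p.1).
rewrite /slot_lo /slot_hi; case: ifP => _; split=> //.
- by rewrite subr_ge0; apply: le_trans (h _) r1.
- by rewrite gerBl.
exact: le_trans (h _) r1.
Qed.

(* Even blocks fill [0, 1] from the left and odd blocks from the right, so the slots
   of adjacent vertices are disjoint. *)
Lemma slot_set_stable x t : path_block_polytope R n m x ->
  stable (@block_adj m n) (slot_set x t).
Proof.
move=> [x0 h].
suff H (p q : 'I_m * 'I_n) : p \in slot_set x t -> q \in slot_set x t -> block_adj p q ->
    (p.1 < q.1)%N || (p.1 == q.1) && (p.2 < q.2)%N -> False.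
  apply/forall_inP => p pS; apply/forall_inP => q qS; apply/negP => e.
  have e' : block_adj q p by rewrite block_adj_sym.
  case: (ltngtP p.1 q.1) => h1.
  - by apply: (H p q) => //; rewrite h1.
  - by apply: (H q p) => //; rewrite h1.
  have h1' : p.1 = q.1 by apply: val_inj.
  case: (ltngtP p.2 q.2) => h2.
  - by apply: (H p q) => //; rewrite h1' eqxx h2 orbT.
  - by apply: (H q p) => //; rewrite h1' eqxx h2 orbT.
  move: e; have -> : p = q; last by rewrite /block_adj eqxx.
  by case: p q h1' h2 {pS qS h1 e'} => i j [i' j'] /= -> /val_inj ->.
rewrite !inE => /andP[p1 p2] /andP[q1 q2] /and3P[_ a1 a2] /orP[lt|/andP[/eqP e lt]].
  have e : q.1 = p.1.+1 :> nat by apply/eqP; rewrite eqn_leq a2 lt.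
  have := h _ _ e; have := row_prefix_total p.2.+1 (x0 p.1); have := row_prefix_total q.2.+1 (x0 q.1).
  move: p1 p2 q1 q2; rewrite /slot_lo /slot_hi e /= -/(row_total x p.1) -/(row_total x q.1).
  have := row_prefix_total p.2 (x0 p.1); have := row_prefix_total q.2 (x0 q.1).
  have := row_prefix_total p.2.+1 (x0 p.1); have := row_prefix_total q.2.+1 (x0 q.1).
  by case: (odd p.1) => /=; lra.
have := row_prefix_le (x0 q.1) lt; move: p1 p2 q1 q2; rewrite /slot_lo /slot_hi e.
by case: (odd q.1) => /=; lra.
Qed.

(** The entry [x i j] is the length of its slot, hence the total weight of the times [t k] in that
    slot, for weights adapted to all slot end points. So [x] is the weighted mean of the incidence
    vectors of the sets [slot_set x (t k)]. *)
Lemma sub_STAB x : path_block_polytope R n m x -> STAB R (@block_adj m n) x.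
Proof.
move=> xP; have [x0 _] := xP.
pose L := [seq slot_lo x p | p : 'I_m * 'I_n] ++ [seq slot_hi x p | p : 'I_m * 'I_n].
have lohi p : slot_lo x p <= slot_hi x p by rewrite -subr_ge0 slot_hiB.
have [|N [t [w [w0 w1 wL]]]] := @step_weights R L.
  apply/allP => c; rewrite mem_cat => /orP[]/mapP[p _ ->].
    have [-> b] := slot_bounds p xP; exact: le_trans (lohi p) b.
  have [b ->] := slot_bounds p xP; rewrite andbT; exact: le_trans b (lohi p).
exists N, (fun k => \matrix_(i, j) ((i, j) \in slot_set x (t k))%:R), w; split=> //.
  by move=> k; exists (slot_set x (t k)); split=> //; apply: slot_set_stable.
apply/matrixP => i j; rewrite summxE.
have loL : slot_lo x (i, j) \in L by rewrite mem_cat map_f ?mem_enum.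
have hiL : slot_hi x (i, j) \in L by rewrite mem_cat map_f ?mem_enum ?orbT.
rewrite -[LHS](slot_hiB x (i, j)).
have -> : slot_hi x (i, j) - slot_lo x (i, j) =
    (1 - slot_lo x (i, j)) - (1 - slot_hi x (i, j)) by ring.
rewrite -(wL _ loL) -(wL _ hiL) -sumrB; apply: eq_bigr => k _.
rewrite !mxE -mulrBr inE; congr (_ * _); move: (lohi (i, j)).
move: (slot_lo _ _) (slot_hi _ _) => u v uv.
by case: (leP u (t k)) => h1; case: (leP v (t k)) => h2 /=; rewrite ?subrr ?subr0 //; lra.
Qed.

End StableSets.

(** * Facets of full-dimensional polytopes *)

Local Open Scope classical_set_scope.

Lemma small_positive (R : realFieldType) (K : finType) (s d : K -> R) :
  (forall k, 0 < d k) -> exists2 eps, 0 < eps & forall k, eps * s k <= d k.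
Proof.
move=> d0; pose t := 1 + \sum_k `|s k| / d k.
have t0 : 0 < t by rewrite ltr_pwDl // sumr_ge0 // => k _; rewrite divr_ge0 // ltW.
exists t^-1; first by rewrite invr_gt0.
move=> k; rewrite ler_pdivrMl //; apply: le_trans (ler_norm _) _.
rewrite -ler_pdivrMr // /t (bigD1 k) //= addrCA lerDl addr_ge0 // sumr_ge0 // => l _.
by rewrite divr_ge0 // ltW.
Qed.

Lemma int_ltDr1 (R : archiNumDomainType) (x y : R) :
  x \is a Num.int -> y \is a Num.int -> x < y -> x + 1 <= y.
Proof. by move=> /intrP[i ->] /intrP[j ->]; rewrite ltr_int -lezD1 -(ler_int R) intrD. Qed.

Section AffineGeometry.
Variables (R : realType) (m n : nat).
Implicit Types (x y v : 'M[R]_(m, n)) (A Q F : set 'M[R]_(m, n)).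

Lemma innerD (c x y : 'M[R]_(m, n)) : inner c (x + y) = inner c x + inner c y.
Proof.
rewrite /inner -big_split; apply: eq_bigr => i _.
by rewrite -big_split; apply: eq_bigr => j _; rewrite mxE mulrDr.
Qed.

Lemma innerZ (c x : 'M[R]_(m, n)) (t : R) : inner c (t *: x) = t * inner c x.
Proof.
rewrite /inner mulr_sumr; apply: eq_bigr => i _.
by rewrite mulr_sumr; apply: eq_bigr => j _; rewrite mxE mulrCA.
Qed.

Lemma inner0r (c : 'M[R]_(m, n)) : inner c 0 = 0.
Proof. by apply: big1 => i _; apply: big1 => j _; rewrite mxE mulr0. Qed.

Lemma inner_sum (c : 'M[R]_(m, n)) (I : finType) (p : I -> 'M[R]_(m, n)) :
  inner c (\sum_k p k) = \sum_k inner c (p k).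
Proof. exact: (big_morph (inner c) (innerD c) (inner0r c)). Qed.

Lemma inner0 x : inner 0 x = 0.
Proof. by apply: big1 => i _; apply: big1 => j _; rewrite mxE mul0r. Qed.

Lemma inner_self_eq0 (c : 'M[R]_(m, n)) : inner c c <= 0 -> c = 0.
Proof.
move=> h; have h0 i : 0 <= \sum_j c i j * c i j.
  by apply: sumr_ge0 => j _; rewrite -expr2 sqr_ge0.
have e : inner c c = 0 by apply/eqP; rewrite eq_le h sumr_ge0.
apply/matrixP => i j; rewrite mxE; apply/eqP.
have hi : \sum_j c i j * c i j = 0 by apply: (psumr_eq0P (fun i _ => h0 i) e).
have hij : c i j * c i j = 0.
  by apply: (psumr_eq0P _ hi) => // k _; rewrite -expr2 sqr_ge0.
by rewrite -sqrf_eq0 expr2 hij.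
Qed.

Lemma affine_indep_widen (E : lmodType R) N N' (p : 'I_N -> E) : (N' <= N)%N ->
  affine_indep p -> exists f : 'I_N' -> 'I_N, affine_indep (p \o f).
Proof.
move=> /subnKC e; move: (N - N')%N e => r e; subst N => hp.
exists (lshift r) => w w1 wp k.
pose w' (l : 'I_(N' + r)) := match split l with inl k => w k | inr _ => 0 end.
have wl l : w' (lshift r l) = w l by rewrite /w' (unsplitK (inl l)).
have wr l : w' (rshift N' l) = 0 by rewrite /w' (unsplitK (inr l)).
rewrite -wl; apply: hp; rewrite big_split_ord /=.
  by rewrite [X in _ + X]big1 // addr0 -[RHS]w1; apply: eq_bigr => l _; rewrite wl.
rewrite [X in _ + X]big1 => [|l _]; last by rewrite wr scale0r.
by rewrite addr0 -[RHS]wp; apply: eq_bigr => l _; rewrite wl.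
Qed.

(** The vectors [(1, p k)] outnumber their dimension [1 + m n], and a linear relation between them
    is an affine one between the points. *)
Lemma affine_indep_bound (p : 'I_(m * n).+2 -> 'M[R]_(m, n)) : ~ affine_indep p.
Proof.
move=> hp.
pose M : 'M[R]_((m * n).+2, 1 + m * n) := \matrix_k row_mx (1 : 'rV_1) (mxvec (p k)).
have : kermx M != 0.
  rewrite kermx_eq0 /row_free; apply/negP => /eqP rM.
  by have := rank_leq_col M; rewrite rM add1n ltnn.
case/rowV0Pn => v /sub_kermxP vM /eqP; apply.
have w0 k : v 0 k = 0.
  apply: (hp (fun k => v 0 k)).
    have := congr1 (fun M : 'rV[R]_(1 + m * n) => M 0 (lshift _ 0)) vM.
    rewrite !mxE => h; rewrite -[RHS]h; apply: eq_bigr => l _.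
    by rewrite mxE row_mxEl mxE eqxx mulr1.
  apply: (can_inj mxvecK); rewrite linear0 linear_sum /=; apply/rowP => l.
  have := congr1 (fun M : 'rV[R]_(1 + m * n) => M 0 (rshift _ l)) vM.
  rewrite summxE !mxE => h; rewrite -[RHS]h; apply: eq_bigr => k' _.
  by rewrite linearZ /= [LHS]mxE [M _ _]mxE row_mxEr.
by apply/rowP => k; rewrite w0 mxE.
Qed.

Lemma full_dimensional_intro A v (t : R) : t != 0 -> A v ->
  (forall i j, A (v + t *: delta_mx i j)) -> full_dimensional A.
Proof.
move=> t0 Av Ad; split; last by move=> p _; apply: affine_indep_bound.
pose p (k : 'I_(m * n).+1) := if unlift ord0 k is Some l
  then v + t *: vec_mx (delta_mx 0 l) else v.
exists p; split.
  rewrite /p => k; case: (unlift ord0 k) => [l|] //.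
  by case/mxvec_indexP: l => i j; rewrite vec_mx_delta.
move=> w w0 wp.
have wl l : w (lift ord0 l) = 0.
  have : \sum_l w (lift ord0 l) *: (t *: vec_mx (delta_mx 0 l)) = 0 :> 'M[R]_(m, n).
    rewrite -[RHS]wp; transitivity ((\sum_k w k) *: v + \sum_l w (lift ord0 l) *: (t *: vec_mx (delta_mx 0 l))).
      by rewrite w0 scale0r add0r.
    rewrite !big_ord_recl /p unlift_none scalerDl -addrA; congr (_ + _).
    rewrite scaler_suml -big_split /=; apply: eq_bigr => k _.
    by rewrite liftK scalerDr.
  move/(congr1 mxvec); rewrite linear0 linear_sum /=.
  rewrite (eq_bigr (fun l => (w (lift ord0 l) * t) *: delta_mx 0 l)) => [|k _]; last first.
    by rewrite scalerA linearZ /= vec_mxK.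
  move/rowP/(_ l); rewrite summxE !mxE (bigD1 l) //= !mxE !eqxx mulr1 big1 ?addr0.
    by move/eqP; rewrite mulf_eq0 (negbTE t0) orbF => /eqP.
  by move=> k kl; rewrite !mxE eqxx /= eq_sym (negbTE kl) mulr0.
move=> k; case: (unliftP ord0 k) => [l ->|->] //.
by move: w0; rewrite big_ord_recl big1 ?addr0.
Qed.

(* If no constraint is tight on all of a facet, averaging gives a point of the facet in
   the interior, where the supporting functional must vanish. *)
Lemma facet_tight (K : finType) (c : K -> 'M[R]_(m, n)) Q F :
  (forall y, Q y <-> forall k, inner (c k) y <= 1) -> is_facet Q F ->
  exists k, forall y, F y -> inner (c k) y = 1.
Proof.
move=> QE [[c0 [b [Qb FE]]] [d [[[pQ [pQQ pQi]] _] [[p [pF pi]] Fd]]]].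
apply: contrapT => /forallNP H.
have H' k : exists y, F y /\ inner (c k) y < 1.
  have /existsNP[y /not_implyP[Fy /eqP ne]] := H k; exists y; split=> //.
  rewrite lt_neqAle ne /=; have := Fy; rewrite FE => -[/QE Qy _]; exact: Qy.
have [y yP] := choice H'.
(* The mean is taken over one slack point for each constraint and over [p ord0], which keeps it
   defined for empty [K]. *)
pose N := (#|K|.+1)%:R : R; have N0 : 0 < N by rewrite ltr0Sn.
have [z inner_z] : exists z, forall c1,
    inner c1 z = N^-1 * (inner c1 (p ord0) + \sum_k inner c1 (y k)).
  exists (N^-1 *: (p ord0 + \sum_k y k)) => c1.
  by rewrite innerZ innerD inner_sum.
have pF0 := pF ord0; rewrite FE in pF0; case: pF0 => /QE Qp0 bp0.
have yF k : Q (y k) /\ inner c0 (y k) = b by have [] := yP k; rewrite FE.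
have z_lt k : inner (c k) z < 1.
  rewrite inner_z -ltr_pdivlMl ?invr_gt0 // invrK mulr1 (bigD1 k) //= addrCA.
  have -> : N = 1 + (1 + (#|K|.-1)%:R).
    have K0 : (0 < #|K|)%N by apply/card_gt0P; exists k.
    by rewrite /N -[in LHS](prednK K0) -natr1 -natr1; ring.
  apply: ltr_leD; first by have [] := yP k.
  apply: lerD; first exact: Qp0.
  have -> : (#|K|.-1)%:R = \sum_(l | l != k) 1 :> R.
    rewrite sumr_const; congr (_%:R).
    by rewrite -(cardC1 k); apply: eq_card => l; rewrite !inE.
  by apply: ler_sum => l _; have [/QE] := yF l.
have z_b : inner c0 z = b.
  rewrite inner_z bp0 (eq_bigr (fun=> b)) => [|k _]; last by have [] := yF k.
  rewrite sumr_const -[b *+ _]mulr_natr.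
  have -> : b + b * #|K|%:R = b * N by rewrite /N -natr1; ring.
  by rewrite mulrC mulfK ?gt_eqF.
have [eps eps0 epsP] : exists2 eps, 0 < eps & forall k, eps * inner (c k) c0 <= 1 - inner (c k) z.
  by apply: small_positive => k; rewrite subr_gt0.
have c00 : c0 = 0.
  apply: inner_self_eq0; have : Q (z + eps *: c0).
    by apply/QE => k; rewrite innerD innerZ; have := epsP k; lra.
  by move/Qb; rewrite innerD innerZ z_b gerDl pmulr_rle0.
have b0 : b = 0 by rewrite -z_b c00 inner0.
(* With [c0 = 0] and [b = 0] the face is all of [Q], which has too many affinely independent points
   for a facet. *)
apply: (Fd pQ) => // k; rewrite FE; split=> //.
by rewrite c00 inner0 b0.
Qed.

(** The independent points of a facet lie on a hyperplane [inner (c k) y = 1]. As it avoids the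
    origin, they are linearly independent and hence span the space, so every point of [Q] on it is
    an affine combination of them and belongs to the facet. *)
Lemma reflexive_of_system (K : finType) (c : K -> 'M[int]_(m, n)) Q :
  (forall k, primitive_vector (c k)) ->
  (forall y, Q y <-> forall k, inner (map_mx intr (c k)) y <= 1) ->
  full_dimensional Q -> reflexive_polytope Q.
Proof.
move=> cp QE [[pQ [pQQ pQi]] _] F FF; have [k Fk] := facet_tight QE FF.
exists (c k); split=> //; first by move=> y /QE.
have [[c0 [b [Qb FE]]] [d [[_ Qd] [[p [pF pi]] _]]]] := FF.
have dmn : (m * n <= d.+1)%N.
  rewrite leqNgt; apply/negP => lt.
  have [f fi] : exists f : 'I_d.+3 -> 'I_(m * n).+1, affine_indep (pQ \o f).
    by apply: affine_indep_widen pQi; rewrite ltnS.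
  by apply: Qd fi => i; apply: pQQ.
pose M : 'M[R]_(d.+1, m * n) := \matrix_i mxvec (p i).
have freeM : row_free M.
  rewrite -kermx_eq0; apply/negP => /negP/rowV0Pn[v /sub_kermxP vM /eqP]; apply.
  have vp : \sum_i v 0 i *: p i = 0.
    apply: (can_inj mxvecK); rewrite linear0 linear_sum /= -[RHS]vM mulmx_sum_row.
    by apply: eq_bigr => i _; rewrite rowK linearZ.
  have v0 : \sum_i v 0 i = 0.
    have := congr1 (inner (map_mx intr (c k))) vp; rewrite inner0r inner_sum => h; rewrite -[RHS]h.
    by apply: eq_bigr => i _; rewrite innerZ Fk // mulr1.
  by apply/rowP => i; rewrite mxE (pi (fun i => v 0 i)).
have fullM : row_full M.
  rewrite /row_full eqn_leq rank_leq_col; move: freeM; rewrite /row_free => /eqP ->.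
  exact: dmn.
apply/seteqP; split=> y.
  by move=> Fy; split; [move: Fy; rewrite FE => -[] | exact: Fk].
move=> [Qy ky]; rewrite FE; split=> //.
have /submxP[w yw] := submx_full (mxvec y) fullM.
have yE : y = \sum_i w 0 i *: p i.
  apply: (can_inj mxvecK); rewrite linear_sum /= yw mulmx_sum_row.
  by apply: eq_bigr => i _; rewrite rowK linearZ.
have w1 : \sum_i w 0 i = 1.
  rewrite -[RHS]ky yE inner_sum; apply: eq_bigr => i _.
  by rewrite innerZ Fk // mulr1.
rewrite yE inner_sum (eq_bigr (fun i => w 0 i * b)) => [|i _].
  by rewrite -mulr_suml w1 mul1r.
by rewrite innerZ; have := pF i; rewrite FE => -[_ ->].
Qed.

End AffineGeometry.

(** * The path block polytope *)

Section BlockPolytope.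
Variables (R : realType) (m' a' : nat).
Let m := m'.+2.
Let a := a'.+1.
Implicit Types x y : 'M[R]_(m, a).

Local Notation P := (path_block_polytope R a m).

Definition block_pair x (i : 'I_m'.+1) :=
  row_total x (widen_ord (leqnSn _) i) + row_total x (lift ord0 i).

Lemma block_pairP (Pr : R -> Prop) x :
  (forall i i' : 'I_m, i' = i.+1 :> nat -> Pr (row_total x i + row_total x i')) <->
  forall i, Pr (block_pair x i).
Proof.
split=> [h i|h i i' e]; first exact: h.
have im : (i < m'.+1)%N by rewrite -ltnS -e.
have := h (Ordinal im); rewrite /block_pair.
have -> : widen_ord (leqnSn _) (Ordinal im) = i by apply: val_inj.
by have -> : lift ord0 (Ordinal im) = i' by apply: val_inj; rewrite /= e.
Qed.

Lemma row_totalZ (t : R) x i : row_total (t *: x) i = t * row_total x i.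
Proof. by rewrite /row_total mulr_sumr; apply: eq_bigr => j _; rewrite mxE. Qed.

Lemma row_totalD x y i : row_total (x + y) i = row_total x i + row_total y i.
Proof. by rewrite /row_total -big_split; apply: eq_bigr => j _; rewrite mxE. Qed.

Lemma row_total_const (t : R) i : row_total (const_mx t : 'M[R]_(m, a)) i = a%:R * t.
Proof.
rewrite /row_total (eq_bigr (fun=> t)) => [|j _]; last by rewrite mxE.
by rewrite sumr_const card_ord mulr_natl.
Qed.

Lemma row_total_delta i j k : row_total (delta_mx i j : 'M[R]_(m, a)) k = (k == i)%:R.
Proof.
rewrite /row_total (bigD1 j) //= mxE eqxx andbT big1 ?addr0 // => l lj.
by rewrite mxE (negbTE lj) andbF.
Qed.

Lemma entry_le_row x i j : (forall j, 0 <= x i j) -> x i j <= row_total x i.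
Proof. by move=> x0; rewrite /row_total (bigD1 j) //= lerDl sumr_ge0. Qed.

Lemma dilate_blockP q y : dilate q P y <->
  (forall i j, 0 <= y i j) /\ (forall i, block_pair y i <= q%:R).
Proof.
rewrite -(block_pairP (fun t => t <= q%:R)); split=> [[x [x0 h] <-]|[y0 h]].
  split=> [i j|i i' e]; first by rewrite mxE mulr_ge0.
  by rewrite !row_totalZ -mulrDr -[leRHS]mulr1 ler_wpM2l // h.
case: (posnP q) => [q0|q0]; last first.
  have q0' : q%:R != 0 :> R by rewrite pnatr_eq0 -lt0n.
  exists (q%:R^-1 *: y); last by rewrite scalerA mulfV // scale1r.
  split=> [i j|i i' e]; first by rewrite mxE mulr_ge0 ?invr_ge0.
  rewrite -!/(row_total _ _) !row_totalZ -mulrDr mulrC ler_pdivrMr ?ltr0n // mul1r.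
  exact: h.
exists 0.
  split=> [i j|i i' e]; first by rewrite mxE.
  by rewrite !big1 ?addr0 // => j _; rewrite mxE.
rewrite scaler0; apply/matrixP => i j; rewrite mxE; apply/esym/eqP.
rewrite eq_le y0 andbT; apply: le_trans (entry_le_row _ (y0 i)) _.
have t0 k : 0 <= row_total y k by apply: sumr_ge0.
have [i' /orP[]/eqP e] := block_neighbour i; have := h _ _ e; rewrite q0;
  by have := t0 i'; lra.
Qed.

Lemma interior_blockP q y : (dilate q P)° y <->
  (forall i j, 0 < y i j) /\ (forall i, block_pair y i < q%:R).
Proof.
split; last first.
  move=> [y0 h].
  (* Moving all entries by at most [eps] changes an entry by at most [eps] and the sum of two rows
     by at most [2 a eps]. *)
  pose s (k : 'I_m * 'I_a + 'I_m'.+1) : R := if k is inl _ then 1 else (a + a)%:R.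
  pose d (k : 'I_m * 'I_a + 'I_m'.+1) : R :=
    match k with inl p => y p.1 p.2 | inr i => q%:R - block_pair y i end.
  have [|eps eps0 hs] := @small_positive R _ s d.
    by case=> [p|i]; rewrite /d ?subr_gt0.
  exists (fun i j => ball (y i j) eps).
    by move=> i j; apply: nbhsx_ballx.
  move=> z hz; have hz' i j : `|y i j - z i j| < eps by apply: hz.
  apply/dilate_blockP; split=> [i j|i].
    have := hs (inl (i, j)); rewrite /s /d /= mulr1.
    by have := hz' i j; rewrite ltr_norml => /andP[]; lra.
  have := hs (inr i); rewrite /s /d.
  have hrow k : row_total z k <= row_total y k + a%:R * eps.
    rewrite /row_total; have -> : a%:R * eps = \sum_(j < a) eps by rewrite sumr_const card_ord mulr_natl.
    rewrite -big_split; apply: ler_sum => j _ /=.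
    by have := hz' k j; rewrite ltr_norml => /andP[]; lra.
  rewrite natrD mulrDr /block_pair.
  have := hrow (widen_ord (leqnSn _) i); have := hrow (lift ord0 i); lra.
move=> [U Uy Us].
have perturb i j : exists2 eps, 0 < eps &
    forall s : R, `|s| < eps -> dilate q P (y + s *: delta_mx i j).
  have /nbhs_ballP[eps eps0 hb] := Uy i j; exists eps => // s se; apply: Us => k l.
  rewrite !mxE; case: (eqVneq k i) => [->|ki]; last first.
    by rewrite /= mulr0 addr0; apply: nbhs_singleton.
  case: (eqVneq l j) => [->|lj]; last by rewrite /= mulr0 addr0; apply: nbhs_singleton.
  apply: hb; rewrite /= mulr1 /ball /= opprD addrA subrr sub0r normrN.
  exact: se.
split=> [i j|i].
  have [eps /= eps0 h] := perturb i j; have [|/(_ i j) + _] := iffLR (dilate_blockP _ _) (h (- (eps / 2)) _).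
    by rewrite normrN gtr0_norm; lra.
  by rewrite !mxE !eqxx mulr1; lra.
have [eps /= eps0 h] := perturb (widen_ord (leqnSn _) i) ord0.
have [|_ /(_ i)] := iffLR (dilate_blockP _ _) (h (eps / 2) _).
  by rewrite gtr0_norm; lra.
rewrite /block_pair !row_totalD !row_totalZ !row_total_delta eqxx mulr1.
have : 0 <= (lift ord0 i == widen_ord (leqnSn _) i)%:R :> R by rewrite ler0n.
by move=> /(mulr_ge0 (ltW eps0)); lra.
Qed.

Lemma block_full_dimensional_dilate q : (0 < q)%N -> full_dimensional (dilate q P).
Proof.
move=> q0; apply: (@full_dimensional_intro R m a _ 0 1 (oner_neq0 _)).
  apply/dilate_blockP; split=> [i j|i]; first by rewrite mxE.
  by rewrite /block_pair /row_total !big1 ?addr0 // => j _; rewrite mxE.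
move=> i j; rewrite add0r scale1r; apply/dilate_blockP; split=> [k l|k].
  by rewrite mxE.
rewrite /block_pair !row_total_delta; apply: (@le_trans _ _ 1); last by rewrite ler1n.
have : widen_ord (leqnSn m'.+1) k != lift ord0 k by rewrite -val_eqE /= neq_ltn ltnSn.
case: (eqVneq (widen_ord _ _) i) => [->|_ _]; last by rewrite add0r lern1 leq_b1.
by rewrite eq_sym => /negbTE ->; rewrite addr0.
Qed.

Lemma dilate1 : dilate 1 P = P.
Proof.
apply/seteqP; split=> x; first by move=> [y yP <-]; rewrite scale1r.
by move=> xP; exists x => //; rewrite scale1r.
Qed.

Lemma block_full_dimensional : full_dimensional P.
Proof. by rewrite -dilate1; apply: block_full_dimensional_dilate. Qed.

Lemma row_total_int x i : x \is a mxOver Num.int -> row_total x i \is a Num.int.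
Proof. by move=> /mxOverP xi; apply: rpred_sum. Qed.

(** For integral points the strict inequalities become entries at least 1 and row pairs at most
    [q - 1]. Subtracting 1 from every entry lowers a row pair by [2 a]. *)
Lemma interior_lattice_points q : (2 * a + 1 <= q)%N ->
  lattice_points (dilate q P)° =
  translate (const_mx 1) (lattice_points (dilate (q - (2 * a + 1)) P)).
Proof.
move=> aq; have qE : (q - (2 * a + 1))%:R = q%:R - (a%:R + a%:R + 1) :> R.
  by rewrite natrB // natrD mulSn mul1n natrD.
apply/seteqP; split=> [x [/interior_blockP[x0 h] xi]|_ [x [/dilate_blockP[x0 h] xi] <-]].
  exists (x - const_mx 1); last by rewrite addrC subrK.
  split; last by apply/mxOverP => i j; rewrite !mxE rpredB ?rpred1 ?(mxOverP xi).
  apply/dilate_blockP; split=> [i j|i].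
    rewrite !mxE subr_ge0 -[leLHS]add0r; apply: int_ltDr1 => //; exact: (mxOverP xi).
  rewrite qE /block_pair -scaleN1r !row_totalD !row_totalZ !row_total_const.
  have := int_ltDr1 _ _ (h i); rewrite /block_pair rpredD ?row_total_int // natr_int => /(_ isT isT).
  by lra.
split; last by apply/mxOverP => i j; rewrite !mxE rpredD ?rpred1 ?(mxOverP xi).
apply/interior_blockP; split=> [i j|i]; first by rewrite !mxE ltr_pwDl.
rewrite /block_pair !row_totalD !row_total_const; have := h i; rewrite qE /block_pair.
by lra.
Qed.

Lemma dilate0 : dilate 0 P = [set 0].
Proof.
apply/seteqP; split=> x; first by move=> [y _ <-]; rewrite /= scale0r.
move=> ->; apply/dilate_blockP; split=> [i j|i]; first by rewrite mxE.
by rewrite /block_pair /row_total !big1 ?addr0 // => j _; rewrite mxE.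
Qed.

Lemma interior_lattice_point :
  lattice_points (dilate (2 * a + 1) P)° = [set const_mx 1].
Proof.
rewrite interior_lattice_points // subnn dilate0; apply/seteqP; split=> x.
  by move=> [y [-> _] <-]; rewrite /= addr0.
move=> ->; exists 0; last by rewrite addr0.
by split=> //; apply/mxOverP => i j; rewrite mxE rpred0.
Qed.

(** Two rows with entries at least 1 have sum at least [2 a], which has to be less than [k]. *)
Lemma block_codegree : is_codegree P (2 * a + 1).
Proof.
split; first by rewrite addn1.
  by exists (const_mx 1); rewrite interior_lattice_point.
move=> k k0 [x [/interior_blockP[x0 h] xi]]; rewrite -(ler_nat R).
have x1 i j : 1 <= x i j.
  rewrite -[leLHS]add0r; apply: int_ltDr1 => //; exact: (mxOverP xi).
have row_ge i : a%:R <= row_total x i.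
  rewrite -[a%:R]mulr1 -(row_total_const 1 i); apply: ler_sum => j _.
  by rewrite mxE.
have := int_ltDr1 _ _ (h ord0); rewrite /block_pair rpredD ?row_total_int // natr_int => /(_ isT isT).
have := row_ge (widen_ord (leqnSn _) ord0); have := row_ge (lift ord0 ord0).
by rewrite natrD mulSn mul1n natrD; lra.
Qed.

Lemma block_STAB : P = STAB R (@block_adj m a).
Proof. by apply/seteqP; split=> x; [apply: sub_STAB | apply: STAB_sub]. Qed.

Lemma block_lattice_polytope : lattice_polytope P.
Proof.
pose V := [seq \matrix_(i, j) ((i, j) \in T)%:R : 'M[R]_(m, a) |
            T : {set 'I_m * 'I_a} <- enum (stable (@block_adj m a))].
exists V; split.
  move=> x /mapP[S _ ->]; apply/mxOverP => i j; rewrite mxE.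
  exact: natr_int.
rewrite block_STAB /STAB; congr (conv _); apply/seteqP; split=> x.
  by move=> [S [sS ->]]; apply/mapP; exists S; rewrite // mem_enum.
by move=> /mapP[S]; rewrite mem_enum => sS ->; exists S.
Qed.

(** Normals for the dilate by [2 a + 1] with the all-one vector moved to the origin: nonnegativity
    reads [- y <= 1], and the bound on a row pair, lowered by [2 a], is 1 as well. *)
Definition block_facet (k : 'I_m * 'I_a + 'I_m'.+1) : 'M[int]_(m, a) :=
  match k with
  | inl p => - delta_mx p.1 p.2
  | inr i => \matrix_(k, l) ((k == widen_ord (leqnSn _) i) || (k == lift ord0 i))%:Z
  end.

Lemma primitive_entry (c : 'M[int]_(m, a)) i j : `|c i j|%N = 1%N -> primitive_vector c.
Proof.
move=> cij; apply/eqP; rewrite -dvdn1.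
apply: (@biggcdn_inf _ i) => //; apply: (@biggcdn_inf _ j) => //.
by rewrite cij.
Qed.

Lemma block_facet_primitive k : primitive_vector (block_facet k).
Proof.
case: k => [[i j]|i].
  by apply: (primitive_entry (i := i) (j := j)); rewrite !mxE !eqxx.
by apply: (primitive_entry (i := lift ord0 i) (j := ord0)); rewrite !mxE eqxx orbT.
Qed.

Lemma inner_facet_entry p y : inner (map_mx intr (block_facet (inl p))) y = - y p.1 p.2.
Proof.
rewrite /inner (bigD1 p.1) //= (bigD1 p.2) //= !mxE !eqxx big1 => [|j jp]; last first.
  by rewrite !mxE (negbTE jp) andbF oppr0 mul0r.
rewrite big1 => [|i ip]; first by rewrite !addr0 mulN1r.
by apply: big1 => j _; rewrite !mxE (negbTE ip) oppr0 mul0r.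
Qed.

Lemma inner_facet_pair i y : inner (map_mx intr (block_facet (inr i))) y = block_pair y i.
Proof.
have ne : lift ord0 i != widen_ord (leqnSn m'.+1) i by rewrite -val_eqE /= neq_ltn ltnSn orbT.
rewrite /inner (bigD1 (widen_ord (leqnSn m'.+1) i)) //= (bigD1 (lift ord0 i)) //= addrA.
rewrite [X in _ + X]big1 ?addr0 => [|k /andP[k1 k2]]; last first.
  by apply: big1 => j _; rewrite !mxE (negbTE k1) (negbTE k2) mul0r.
by congr (_ + _); apply: eq_bigr => j _; rewrite !mxE eqxx ?orbT mul1r.
Qed.

Lemma translated_blockP y :
  translate (- const_mx 1) (dilate (2 * a + 1) P) y <->
  forall k, inner (map_mx intr (block_facet k)) y <= 1.
Proof.
have aE : (2 * a + 1)%:R = a%:R + a%:R + 1 :> R by rewrite natrD mulSn mul1n natrD.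
split=> [[x /dilate_blockP[x0 h] <-] [p|i]|h].
- by rewrite inner_facet_entry !mxE; have := x0 p.1 p.2; lra.
- rewrite inner_facet_pair /block_pair -scaleN1r !row_totalD !row_totalZ !row_total_const.
  by have := h i; rewrite /block_pair aE; lra.
exists (y + const_mx 1); last by rewrite addrC addrK.
apply/dilate_blockP; split=> [i j|i].
  by have := h (inl (i, j)); rewrite inner_facet_entry !mxE /=; lra.
have := h (inr i); rewrite inner_facet_pair /block_pair !row_totalD !row_total_const aE.
by lra.
Qed.

Lemma block_gorenstein : gorenstein P (2 * a + 1).
Proof.
split; [exact: block_full_dimensional | exact: block_lattice_polytope |].
exists (const_mx 1); split; first exact: interior_lattice_point.
apply: reflexive_of_system block_facet_primitive translated_blockP _.
apply: (@full_dimensional_intro R m a _ (- const_mx 1) 1 (oner_neq0 _)).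
  apply/translated_blockP => -[p|i].
    by rewrite inner_facet_entry !mxE opprK.
  rewrite inner_facet_pair /block_pair -scaleN1r !row_totalZ !row_total_const.
  by rewrite mulr1 mulN1r; have := ler0n R a; lra.
move=> i j; apply/translated_blockP => -[p|k].
  by rewrite inner_facet_entry !mxE mul1r opprD opprK gerDl oppr_le0.
rewrite inner_facet_pair /block_pair -scaleN1r !row_totalD !row_totalZ !row_total_const !row_total_delta.
have : 1 <= a%:R :> R by rewrite ler1n.
have b1 (b : bool) : b%:R <= 1 :> R by rewrite lern1 leq_b1.
have := b1 (widen_ord (leqnSn m'.+1) k == i); have := b1 (lift ord0 k == i).
by rewrite !mul1r; lra.
Qed.

(** * Lattice points and Ehrhart counts *)

Definition block_matrix q (x : {ffun 'I_m * 'I_a -> 'I_q.+1}) : 'M[R]_(m, a) :=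
  \matrix_(i, j) (x (i, j))%:R.

Lemma block_matrix_inj q : injective (@block_matrix q).
Proof.
move=> x y e; apply/ffunP => -[i j]; apply/val_inj/eqP => /=.
by rewrite -(eqr_nat R); have /matrixP/(_ i j) := e; rewrite !mxE => ->.
Qed.

Lemma row_total_block_matrix q (x : {ffun 'I_m * 'I_a -> 'I_q.+1}) i :
  row_total (block_matrix x) i = (\sum_j x (i, j))%:R.
Proof. by rewrite natr_sum; apply: eq_bigr => j _; rewrite mxE. Qed.

Lemma lattice_points_dilate q : lattice_points (dilate q P) =
  [set block_matrix x | x in [set` @block_points m' a' q]].
Proof.
apply/seteqP; split=> [y [/dilate_blockP[y0 h] yi]|_ [x xX <-]]; last first.
  split; last by apply/mxOverP => i j; rewrite mxE natr_int.
  apply/dilate_blockP; split=> [i j|]; first by rewrite mxE.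
  apply/(block_pairP (fun t => t <= q%:R)) => i i' e.
  by rewrite !row_total_block_matrix -natrD ler_nat; apply: (block_pointsP _ xX).
have t0 k : 0 <= row_total y k by apply: sumr_ge0.
have yq i j : y i j <= q%:R.
  apply: le_trans (entry_le_row _ (y0 i)) _.
  have h' := iffRL (block_pairP (fun t => t <= q%:R) y) h.
  have [i' /orP[]/eqP e] := block_neighbour i; have := h' _ _ e; have := t0 i'; lra.
have yn i j : ((Num.truncn (y i j))%:R : R) = y i j.
  by rewrite truncnK // natrEint (mxOverP yi) y0.
pose x : {ffun 'I_m * 'I_a -> 'I_q.+1} := [ffun p => inord (Num.truncn (y p.1 p.2))].
have xE i j : x (i, j) = Num.truncn (y i j) :> nat.
  by rewrite ffunE inordK // ltnS -(ler_nat R) yn.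
have yx : block_matrix x = y by apply/matrixP => i j; rewrite mxE xE yn.
exists x => //; apply/block_pointsP => i i' e; rewrite -(ler_nat R) natrD.
rewrite -!row_total_block_matrix yx.
exact: (iffRL (block_pairP (fun t => t <= q%:R) y) h).
Qed.

Lemma ehrhart_count_block q : ehrhart_count P q = #|@block_points m' a' q|.
Proof.
rewrite /ehrhart_count lattice_points_dilate.
have -> : fset_set [set block_matrix x | x in [set` @block_points m' a' q]] =
          [fset block_matrix x | x in @block_points m' a' q]%fset.
  apply/fsetP => y; rewrite in_fset_set; last by apply: finite_image; apply: finite_finpred.
  apply/idP/imfsetP => [/set_mem[x xX <-]|[x xX ->]]; first by exists x.
  by apply/mem_set; exists x.
by rewrite card_in_imfset ?cardE //= => x y _ _; apply: block_matrix_inj.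
Qed.

End BlockPolytope.

Theorem theorem1p6 (R : realType) (a m : nat) (ha : (1 <= a)%N) (hm : (2 <= m)%N) :
  let P : set 'M[R]_(m, a) := path_block_polytope R a m in
  (exists e : rel ('I_m * 'I_a),
     [/\ simple_graph e, chordal e, perfect e & P = STAB R e]) /\
  full_dimensional P /\
  is_codegree P (2 * a + 1) /\
  gorenstein P (2 * a + 1) /\
  (forall q : nat, (2 * a + 1 <= q)%N ->
     lattice_points (dilate q P)° =
     translate (const_mx 1) (lattice_points (dilate (q - (2 * a + 1)) P))) /\
  (exists L : {poly rat}, is_ehrhart_polynomial P L /\
     L \Po (- 'X) =
     (-1) ^+ (a * m) *: (L \Po ('X - ((2 * a + 1)%:R)%:P))) /\
  (exists h : {poly rat},
     [/\ series_eq_quotient (fun q => (ehrhart_count P q)%:R) h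
           ((1 - 'X) ^+ (a * m + 1)),
         size h = (a * (m - 2)).+1,
         rational_function h =
         rational_function 'X ^+ (a * (m - 2)) * eval_at_inverse h
       & unimodal h]).
Proof.
case: a ha => // a' _; case: m hm => [|[|m']] // _ /=.
have [W []] := block_points_gf m' a'.
(* The decomposition [D = N + 2 s] with [N = a (m - 2)] and [s = a]. *)
have -> : (m'.+2 * a'.+1 = a'.+1 * m' + a'.+1.*2)%N by rewrite mulnC !mulnS; lia.
move=> gfW gammaW W0 W1.
have dE : (a'.+1 * m'.+2 = a'.+1 * m' + a'.+1.*2)%N by rewrite !mulnS; lia.
have aE : (2 * a'.+1 + 1 = a'.+1.*2.+1)%N by lia.
have countE q : (ehrhart_count (path_block_polytope R a'.+1 m'.+2) q)%:R =
    #|block_points m' a' q|%:R :> rat by rewrite ehrhart_count_block.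
split.
  exists (@block_adj m'.+2 a'.+1); split; [exact: block_adj_simple
    | exact: block_adj_chordal | exact: block_adj_perfect | exact: block_STAB].
split; first exact: block_full_dimensional.
split; first exact: block_codegree.
split; first exact: block_gorenstein.
split; first exact: interior_lattice_points.
split.
  have [L [LE Lsym]] := quotient_polynomial (c := fun q => #|block_points m' a' q|%:R) gfW gammaW W0 W1.
  by exists L; split; [move=> q; rewrite LE countE | rewrite dE aE].
rewrite !subSS subn0 dE addn1.
exists (\poly_(k < (a'.+1 * m').+1) W`_(k + a'.+1)); split.
- move=> k; under eq_bigr do rewrite countE.
  have gfh := quotient_gf (c := fun q => #|block_points m' a' q|%:R) gfW gammaW W0.
  exact: (has_gf_series_eq_quotient gfh k).
- exact: quotient_size gammaW W0 W1.
- exact: quotient_palindromic gammaW W0 W1.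
exact: quotient_unimodal gammaW W0 W1.
Qed.
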